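(* Let $\Sigma$ be a complete fan in $\mathbb{R}^n$, $\phi$ a strictly concave rational PL function on $\Sigma$, $r\in\mathbb{N}^+$ such that $r\phi$ is integral, $\epsilon\in\mathbb{R}_{>0}^{\Sigma(1)}$, $\sigma\in\Sigma$, and $d\in L_\sigma$. If $\gamma$ is a periodic orbit of $X_{H_{r\phi,\epsilon}}$ in the family $B^\epsilon_\sigma(d)$, then its period is $$T(\gamma)=\frac{1}{|\gcd(\langle c_\sigma(d),e_k\rangle:k=1,\dots,n)|}.$$ In particular, $\gamma$ has period one if and only if $c_\sigma(d)$ is primitive.
   Context: Let $e_1,\dots,e_n$ be the standard basis of $\mathbb{R}^n$. A complete fan $\Sigma$ in $\mathbb{R}^n$ is a finite collection of strongly convex rational polyhedral cones, closed under taking faces and intersections (two cones meet along a common face), whose union is $\mathbb{R}^n$. $\Sigma(k)$ is the set of $k$-dimensional cones; $\sigma(1)$ is the set of rays of a cone $\sigma$; for a ray $\rho$, $u_\rho\in\mathbb{Z}^n$ is its primitive generator. A PL function on $\Sigma$ is a continuous $\phi:\mathbb{R}^n\to\mathbb{R}$ linear on each cone; for $\sigma\in\Sigma(n)$ write $\phi|_\sigma=\langle m_\sigma,\cdot\rangle$. It is rational (resp. integral) if all $m_\sigma\in\mathbb{Q}^n$ (resp. $\mathbb{Z}^n$). It is strictly concave if $\phi(x)=\min_{\sigma\in\Sigma(n)}\langle m_\sigma,x\rangle$ for all $x$ and, for every $\sigma\in\Sigma(n)$, $\phi(x)=\langle m_\sigma,x\rangle$ if and only if $x\in\sigma$. Set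 $P_{r\phi}=\{m\in\mathbb{R}^n:\langle m,u_\rho\rangle\ge r\phi(u_\rho)\ \forall\rho\in\Sigma(1)\}$. For $m\in\mathbb{Z}^n$ let $\chi^m(z)=z_1^{m^{(1)}}\cdots z_n^{m^{(n)}}$ on $(\mathbb{C}^\times)^n$. Define $$\theta_{r\phi}=-\frac{i}{2}\sum_{k=1}^n\frac{\sum_{m\in P_{r\phi}\cap\mathbb{Z}^n}m^{(k)}|\chi^m|^2}{\sum_{m\in P_{r\phi}\cap\mathbb{Z}^n}|\chi^m|^2}\left(\frac{dz_k}{z_k}-\frac{d\overline{z}_k}{\overline{z}_k}\right),\quad \omega_{r\phi}=d\theta_{r\phi},\quad \mu_{r\phi}=\frac{\sum_{m\in P_{r\phi}\cap\mathbb{Z}^n}|\chi^m|^2\,m}{\sum_{m\in P_{r\phi}\cap\mathbb{Z}^n}|\chi^m|^2};$$ $\omega_{r\phi}$ is a symplectic form on $(\mathbb{C}^\times)^n$ and $\mu_{r\phi}$ has image $\operatorname{int}(P_{r\phi})$. Let $r_\rho(m)=\langle m,u_\rho\rangle-r\phi(u_\rho)$ for $\rho\in\Sigma(1)$. For $\epsilon_\rho>0$ let $q_{\epsilon_\rho}(x)=\exp\left(-\frac{x^2}{\epsilon_\rho^2(\epsilon_\rho^2-x^2)}\right)$ for $x\in[0,\epsilon_\rho)$ and $q_{\epsilon_\rho}(x)=0$ for $x\ge\epsilon_\rho$. The polyhedral Hamiltonian is $H_{r\phi,\epsilon}=\sum_{\rho\in\Sigma(1)}q_{\epsilon_\rho}\circ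 r_\rho\circ\mu_{r\phi}$, and $X_{H_{r\phi,\epsilon}}$ is defined by $\omega_{r\phi}(X_{H_{r\phi,\epsilon}},-)=-dH_{r\phi,\epsilon}$. For $\sigma\in\Sigma$ put $U^\epsilon_\sigma=\{z\in(\mathbb{C}^\times)^n:0<r_\rho(\mu_{r\phi}(z))<\epsilon_\rho\ \forall\rho\in\sigma(1)\}$ and $S^\epsilon_\sigma=U^\epsilon_\sigma\cap\bigcap_{\rho\in\Sigma(1)\setminus\sigma(1)}(U^\epsilon_\rho)^c$. Let $c_\sigma(d)=\sum_{\rho\in\sigma(1)}d_\rho u_\rho$ for $d\in\mathbb{Q}_{>0}^{\sigma(1)}$ and $L_\sigma=\{d\in\mathbb{Q}_{>0}^{\sigma(1)}:c_\sigma(d)\in\sigma\cap\mathbb{Z}^n\}$. For $d\in L_\sigma$, the family of orbits of slope $d$ is $B^\epsilon_\sigma(d)=\{z\in\operatorname{int}(S^\epsilon_\sigma): q'_{\epsilon_\rho}(r_\rho(\mu_{r\phi}(z)))=-d_\rho\ \forall\rho\in\sigma(1)\}$.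
   Formalization: Periods are measured in units of 2π: with the displayed forms the least positive period of γ in time is 2π/|gcd|, so the stated formula 1/|gcd| (and ''period one'') is read as T(γ)=least period/(2π); constant orbits (σ={0}) are not counted as periodic. *)

(* Defs.v *)
From HB Require Import structures.
From mathcomp Require Import all_boot all_order all_algebra.
From mathcomp Require Import all_classical all_reals all_analysis.
From mathcomp Require Import complex.

Set Implicit Arguments.
Unset Strict Implicit.
Unset Printing Implicit Defensive.

Import Order.TTheory GRing.Theory Num.Theory.
Import numFieldNormedType.Exports.

Local Open Scope classical_set_scope.
Local Open Scope ring_scope.

(** * Lattice vectors, cones and fans in R^n *)

Definition dot (R : realType) (n : nat) (x y : 'rV[R]_n) : R :=
  \sum_(k < n) x 0 k * y 0 k.

Definition latt (R : realType) (n : nat) (m : 'rV[int]_n) : 'rV[R]_n :=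
  map_mx intr m.

(* [primitive 0] is false, since 0 = 2 * 0. *)
Definition primitive (n : nat) (v : 'rV[int]_n) : Prop :=
  forall (k : int) (w : 'rV[int]_n), v = w *~ k -> `|k| = 1.

Definition gcd_coords (n : nat) (v : 'rV[int]_n) : int :=
  \big[gcdz/0]_(k < n) v 0 k.

Definition cone_of (R : realType) (n l : nat) (s : 'I_l -> 'rV[int]_n) :
    set 'rV[R]_n :=
  [set x | exists2 a : 'I_l -> R, forall i, 0 <= a i
                                & x = \sum_(i < l) a i *: latt R (s i)].

Definition rational_polyhedral (R : realType) (n : nat)
    (sigma : set 'rV[R]_n) : Prop :=
  exists (l : nat) (s : 'I_l -> 'rV[int]_n), sigma = cone_of s.

Definition strongly_convex (R : realType) (n : nat)
    (sigma : set 'rV[R]_n) : Prop :=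
  forall x, sigma x -> sigma (- x) -> x = 0.

(* A face is cut out by a supporting hyperplane; m = 0 gives sigma itself. *)
Definition face (R : realType) (n : nat) (tau sigma : set 'rV[R]_n) : Prop :=
  exists2 m : 'rV[R]_n, forall x, sigma x -> 0 <= dot m x
                      & tau = sigma `&` [set x | dot m x = 0].

(* The dimension of a cone is that of its linear span. *)
Definition has_dim (R : realType) (n : nat) (sigma : set 'rV[R]_n)
    (k : nat) : Prop :=
  exists U : {vspace 'rV[R]_n},
    [/\ forall x, sigma x -> x \in U,
        forall W : {vspace 'rV[R]_n},
          (forall x, sigma x -> x \in W) -> (U <= W)%VS
      & \dim U = k].

Record complete_fan (R : realType) (n : nat)
    (Sigma : set (set 'rV[R]_n)) : Prop := CompleteFan {
  fan_finite : finite_set Sigma;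
  fan_rational : forall sigma, Sigma sigma -> rational_polyhedral sigma;
  fan_strongly_convex : forall sigma, Sigma sigma -> strongly_convex sigma;
  fan_face : forall sigma tau, Sigma sigma -> face tau sigma -> Sigma tau;
  fan_inter : forall sigma tau, Sigma sigma -> Sigma tau ->
    face (sigma `&` tau) sigma /\ face (sigma `&` tau) tau;
  fan_complete : \bigcup_(sigma in Sigma) sigma = setT }.

Definition fan_cones (R : realType) (n : nat) (Sigma : set (set 'rV[R]_n))
    (k : nat) : set (set 'rV[R]_n) :=
  [set sigma | Sigma sigma /\ has_dim sigma k].

Definition rays_of (R : realType) (n : nat) (sigma : set 'rV[R]_n) :
    set (set 'rV[R]_n) :=
  [set rho | face rho sigma /\ has_dim rho 1].

Definition ray_gen (R : realType) (n : nat) (rho : set 'rV[R]_n) :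
    'rV[int]_n :=
  xget 0 [set u | primitive u /\
    rho = [set x | exists2 t : R, 0 <= t & x = t *: latt R u]].

(** * Piecewise linear functions *)

Definition PL (R : realType) (n : nat) (Sigma : set (set 'rV[R]_n))
    (phi : 'rV[R]_n -> R) : Prop :=
  continuous phi /\
  forall sigma, Sigma sigma ->
    exists m : 'rV[R]_n, forall x, sigma x -> phi x = dot m x.

(* m_sigma; it is uniquely determined only when sigma is n-dimensional. *)
Definition slope (R : realType) (n : nat) (phi : 'rV[R]_n -> R)
    (sigma : set 'rV[R]_n) : 'rV[R]_n :=
  xget 0 [set m | forall x, sigma x -> phi x = dot m x].

Definition rational_PL (R : realType) (n : nat) (Sigma : set (set 'rV[R]_n))
    (phi : 'rV[R]_n -> R) : Prop :=
  PL Sigma phi /\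
  forall sigma, fan_cones Sigma n sigma ->
    exists q : 'rV[rat]_n, slope phi sigma = map_mx ratr q.

Definition integral_PL (R : realType) (n : nat) (Sigma : set (set 'rV[R]_n))
    (phi : 'rV[R]_n -> R) : Prop :=
  PL Sigma phi /\
  forall sigma, fan_cones Sigma n sigma ->
    exists m : 'rV[int]_n, slope phi sigma = latt R m.

(* The first two clauses say phi x = min_sigma <m_sigma, x>. *)
Definition strictly_concave (R : realType) (n : nat)
    (Sigma : set (set 'rV[R]_n)) (phi : 'rV[R]_n -> R) : Prop :=
  [/\ forall x sigma, fan_cones Sigma n sigma ->
        phi x <= dot (slope phi sigma) x,
      forall x, exists2 sigma, fan_cones Sigma n sigma
                             & phi x = dot (slope phi sigma) x
    & forall sigma, fan_cones Sigma n sigma ->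
        forall x, phi x = dot (slope phi sigma) x <-> sigma x].

(* Everything below is written for a PL function psi, which stands for r phi. *)

Definition r_ (R : realType) (n : nat) (psi : 'rV[R]_n -> R)
    (rho : set 'rV[R]_n) (m : 'rV[R]_n) : R :=
  dot m (latt R (ray_gen rho)) - psi (latt R (ray_gen rho)).

Definition polytope (R : realType) (n : nat) (Sigma : set (set 'rV[R]_n))
    (psi : 'rV[R]_n -> R) : set 'rV[R]_n :=
  [set m | forall rho, fan_cones Sigma 1 rho ->
    dot m (latt R (ray_gen rho)) >= psi (latt R (ray_gen rho))].

Definition lattice_points (R : realType) (n : nat)
    (Sigma : set (set 'rV[R]_n)) (psi : 'rV[R]_n -> R) : set 'rV[int]_n :=
  [set m | polytope Sigma psi (latt R m)].

(** * The symplectic form on the complex torus *)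

(* C^n as a real normed space: (x, y) stands for x + i y. *)
Definition Cn (R : realType) (n : nat) : normedModType R :=
  ('rV[R]_n * 'rV[R]_n)%type.

(* The coordinate z_k is real linear, so dz_k at any point is also [coord k]. *)
Definition coord (R : realType) (n : nat) (k : 'I_n) (z : Cn R n) : R[i] :=
  Complex (z.1 0 k) (z.2 0 k).

Definition torus (R : realType) (n : nat) : set (Cn R n) :=
  [set z | forall k, coord k z != 0].

Definition chi (R : realType) (n : nat) (m : 'rV[int]_n) (z : Cn R n) : R[i] :=
  \prod_(k < n) coord k z ^ m 0 k.

Definition sqnorm_chi (R : realType) (n : nat) (m : 'rV[int]_n)
    (z : Cn R n) : R :=
  complex.Re (`|chi m z| ^+ 2).

Definition theta (R : realType) (n : nat) (Sigma : set (set 'rV[R]_n))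
    (psi : 'rV[R]_n -> R) (z v : Cn R n) : R :=
  complex.Re (- ('i%C / 2) * \sum_(k < n)
    ((\sum_(m \in lattice_points Sigma psi) (m 0 k)%:~R * sqnorm_chi m z) /
     (\sum_(m \in lattice_points Sigma psi) sqnorm_chi m z))%:C%C *
    (coord k v / coord k z - (coord k v)^*%C / (coord k z)^*%C)).

(* d alpha (v, w) = v (alpha w) - w (alpha v) for constant vector fields. *)
Definition ext_d (R : realType) (n : nat) (alpha : Cn R n -> Cn R n -> R)
    (z v w : Cn R n) : R :=
  'D_v (fun y => alpha y w) z - 'D_w (fun y => alpha y v) z.

Definition omega (R : realType) (n : nat) (Sigma : set (set 'rV[R]_n))
    (psi : 'rV[R]_n -> R) : Cn R n -> Cn R n -> Cn R n -> R :=
  ext_d (theta Sigma psi).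

Definition mu (R : realType) (n : nat) (Sigma : set (set 'rV[R]_n))
    (psi : 'rV[R]_n -> R) (z : Cn R n) : 'rV[R]_n :=
  (\sum_(m \in lattice_points Sigma psi) sqnorm_chi m z)^-1 *:
  (\sum_(m \in lattice_points Sigma psi) sqnorm_chi m z *: latt R m).

(** * The polyhedral Hamiltonian and its orbits *)

(* Only its values at x >= 0 matter: r_rho is nonnegative on the polytope. *)
Definition q_ (R : realType) (e x : R) : R :=
  if x < e then expR (- (x ^+ 2 / (e ^+ 2 * (e ^+ 2 - x ^+ 2)))) else 0.

Definition hamiltonian (R : realType) (n : nat) (Sigma : set (set 'rV[R]_n))
    (psi : 'rV[R]_n -> R) (eps : set 'rV[R]_n -> R) (z : Cn R n) : R :=
  \sum_(rho \in fan_cones Sigma 1) q_ (eps rho) (r_ psi rho (mu Sigma psi z)).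

Definition hamiltonian_vf (R : realType) (n : nat)
    (Sigma : set (set 'rV[R]_n)) (psi : 'rV[R]_n -> R) (H : Cn R n -> R)
    (X : Cn R n -> Cn R n) : Prop :=
  forall z, torus z -> forall v, omega Sigma psi z (X z) v = - 'D_v H z.

Definition U_ (R : realType) (n : nat) (Sigma : set (set 'rV[R]_n))
    (psi : 'rV[R]_n -> R) (eps : set 'rV[R]_n -> R)
    (sigma : set 'rV[R]_n) : set (Cn R n) :=
  [set z | torus z /\ forall rho, rays_of sigma rho ->
    0 < r_ psi rho (mu Sigma psi z) < eps rho].

Definition S_ (R : realType) (n : nat) (Sigma : set (set 'rV[R]_n))
    (psi : 'rV[R]_n -> R) (eps : set 'rV[R]_n -> R)
    (sigma : set 'rV[R]_n) : set (Cn R n) :=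
  U_ Sigma psi eps sigma `&`
  \bigcap_(rho in fan_cones Sigma 1 `\` rays_of sigma) ~` U_ Sigma psi eps rho.

(* d is indexed by sigma(1); its values outside sigma(1) are never used. *)
Definition c_ (R : realType) (n : nat) (sigma : set 'rV[R]_n)
    (d : set 'rV[R]_n -> rat) : 'rV[R]_n :=
  \sum_(rho \in rays_of sigma) ratr (d rho) *: latt R (ray_gen rho).

Definition L_ (R : realType) (n : nat) (sigma : set 'rV[R]_n) :
    set (set 'rV[R]_n -> rat) :=
  [set d | [/\ forall rho, rays_of sigma rho -> 0 < d rho,
               sigma (c_ sigma d)
             & exists c : 'rV[int]_n, c_ sigma d = latt R c]].

Definition B_ (R : realType) (n : nat) (Sigma : set (set 'rV[R]_n))
    (psi : 'rV[R]_n -> R) (eps : set 'rV[R]_n -> R)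
    (sigma : set 'rV[R]_n) (d : set 'rV[R]_n -> rat) : set (Cn R n) :=
  [set z | interior (S_ Sigma psi eps sigma) z /\
    forall rho, rays_of sigma rho ->
      ((q_ (eps rho))^`())%classic (r_ psi rho (mu Sigma psi z)) = - ratr (d rho)].

Definition periodic (R : realType) (n : nat) (gamma : R -> Cn R n)
    (T : R) : Prop :=
  0 < T /\ forall t, gamma (t + T) = gamma t.

(* Periodic orbits are, as usual, not equilibria. *)
Definition periodic_orbit (R : realType) (n : nat) (X : Cn R n -> Cn R n)
    (gamma : R -> Cn R n) : Prop :=
  [/\ forall t, torus (gamma t),
      forall t, is_derive (t : R^o) 1 gamma (X (gamma t)),
      exists T, periodic gamma T
    & exists t, gamma t <> gamma 0].

Definition minimal_period (R : realType) (n : nat) (gamma : R -> Cn R n)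
    (T : R) : Prop :=
  periodic gamma T /\ forall T', periodic gamma T' -> T <= T'.

(* Convention: the circle of arguments is R/Z, i.e. periods are measured in
   units of 2 pi.  With z_k = exp (s_k + i t_k) one has omega = sum_k
   d mu_k /\ d t_k, so on the family of slope d the flow of X_H is
   t_k' = - <c(d), e_k> with t_k in R / 2 pi Z: a full turn at unit angular
   speed takes time 2 pi, and it is this amount of time that has period one. *)
Definition has_period (R : realType) (n : nat) (gamma : R -> Cn R n)
    (T : R) : Prop :=
  minimal_period gamma (2 * pi * T).

(* Main.v *)
Require Import Defs.
From HB Require Import structures.
From mathcomp Require Import all_boot all_order all_algebra finmap.
From mathcomp Require Import all_classical all_reals all_analysis.
From mathcomp Require Import complex ring lra zify.

Set Implicit Arguments.
Unset Strict Implicit.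
Unset Printing Implicit Defensive.

Import Order.TTheory GRing.Theory Num.Theory.
Import numFieldNormedType.Exports.

Local Open Scope classical_set_scope.
Local Open Scope ring_scope.

(** Write [z_k = exp (s_k + i t_k)] and let [mu] be the average of the lattice points
    [m] of the polytope with weights [|chi^m|^2].  Then [theta = sum_k mu_k dt_k] and
    [d mu (v) = 2 Cov (d log|z| (v))], where [Cov] is the covariance matrix of the
    weighted lattice points.  It is positive definite, since the slopes of [r phi] on
    the maximal cones are lattice points of the polytope and span affinely, by strict
    concavity.  On the family of slope [d], [dH = - <d mu, c(d)>]: the rays of [sigma]
    contribute their [q' = - d_rho], and [H] is locally independent of the others.
    Inverting [omega] gives [X_k = - i c_k z_k], so orbits are rotations
    [z_k(t) = z_k(0) exp (- i c_k t)], and Bezout identifies the common periods.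

    The lattice points must be finitely many (an infinite [\sum] is [0]).  For a maximal
    cone, strict concavity yields a linear form [w] positive on it; the
    minimum of [<m, x> / <w, x>] over the cone is attained on a face, which
    contains a ray of the fan, so the inequalities at the rays bound [m]. *)

(** * Pairing and gcd of coordinates *)

(** Registered as a linear structure just below, so that sums pass through [dot m] and its kernel
    becomes a subspace via [linfun]. *)
Lemma dot_is_linear (R : realType) (n : nat) (m : 'rV[R]_n) :
  linear (dot m : 'rV[R]_n -> R^o).
Proof.
move=> a x y; rewrite /dot scaler_sumr -big_split/=; apply: eq_bigr => k _.
by rewrite !mxE /GRing.scale/=; ring.
Qed.

HB.instance Definition _ (R : realType) (n : nat) (m : 'rV[R]_n) :=
  GRing.isLinear.Build R 'rV[R]_n R^o *:%R (dot m) (dot_is_linear m).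

Section Dot.
Variables (R : realType) (n : nat).
Implicit Types (x y m : 'rV[R]_n).

Lemma dotC x y : dot x y = dot y x.
Proof. by apply: eq_bigr => k _; rewrite mulrC. Qed.

Lemma dotDr m x y : dot m (x + y) = dot m x + dot m y.
Proof. exact: (linearD (dot m)). Qed.

Lemma dotBr m x y : dot m (x - y) = dot m x - dot m y.
Proof. exact: (linearB (dot m)). Qed.

Lemma dotNr m x : dot m (- x) = - dot m x.
Proof. exact: (linearN (dot m)). Qed.

Lemma dot0r m : dot m 0 = 0.
Proof. exact: (linear0 (dot m)). Qed.

Lemma dotZr m a x : dot m (a *: x) = a * dot m x.
Proof. by have := dot_is_linear m a x 0; rewrite !addr0 dot0r addr0. Qed.

Lemma dot_sumr I (s : seq I) (P : pred I) m (F : I -> 'rV[R]_n) :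
  dot m (\sum_(i <- s | P i) F i) = \sum_(i <- s | P i) dot m (F i).
Proof. exact: (linear_sum (dot m)). Qed.

Lemma dotBl x y m : dot (x - y) m = dot x m - dot y m.
Proof. by rewrite dotC dotBr !(dotC m). Qed.

Lemma dotZl a x m : dot (a *: x) m = a * dot x m.
Proof. by rewrite dotC dotZr dotC. Qed.

Lemma dot_suml I (s : seq I) (P : pred I) m (F : I -> 'rV[R]_n) :
  dot (\sum_(i <- s | P i) F i) m = \sum_(i <- s | P i) dot (F i) m.
Proof. by rewrite dotC dot_sumr; apply: eq_bigr => i _; rewrite dotC. Qed.

Lemma dot_delta x k : dot x (delta_mx 0 k) = x 0 k.
Proof.
rewrite /dot (bigD1 k)//= big1 ?addr0 => [|j jk]; first by rewrite !mxE !eqxx mulr1.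
by rewrite !mxE (negbTE jk) andbF mulr0.
Qed.

Lemma dotxx_gt0 x : x != 0 -> 0 < dot x x.
Proof.
move=> x0; have [k xk] : exists k, x 0 k != 0.
  apply/existsP; apply: contraNT x0; rewrite negb_exists => /forallP x0.
  by apply/eqP/rowP => k; rewrite mxE; apply/eqP/negbNE/x0.
rewrite /dot (bigD1 k)//= ltr_pwDl// ?sumr_ge0// => [|i _].
  by rewrite -expr2 lt_def sqrf_eq0 xk sqr_ge0.
by rewrite -expr2 sqr_ge0.
Qed.

Lemma latt_eq0 (v : 'rV[int]_n) : (latt R v == 0) = (v == 0).
Proof.
apply/eqP/eqP => [|->]; last by apply/rowP => k; rewrite !mxE.
by move=> /rowP v0; apply/rowP => k; have := v0 k; rewrite !mxE => /eqP; rewrite intr_eq0 => /eqP.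
Qed.

Lemma lattMz (v : 'rV[int]_n) (k : int) : latt R (v *~ k) = k%:~R *: latt R v.
Proof.
apply/rowP => j; rewrite !mxE -[v *~ k]scaler_int mxE intz.
by rewrite [(k * _)%:~R]intrM.
Qed.

End Dot.

Section GcdCoords.
Variable n : nat.
Implicit Types v w : 'rV[int]_n.

Lemma mulrz_coord w (e : int) k : (w *~ e) 0 k = w 0 k * e.
Proof. by rewrite -scaler_int mxE intz mulrC. Qed.

Lemma gcd_coords_dvd v k : (gcd_coords v %| v 0%R k)%Z.
Proof.
rewrite /gcd_coords; have : k \in index_enum 'I_n by rewrite mem_index_enum.
elim: (index_enum _) => // j s IH; rewrite in_cons big_cons => /orP[/eqP->|/IH].
  exact: dvdz_gcdl.
exact/dvdz_trans/dvdz_gcdr.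
Qed.

Lemma dvd_gcd_coords (e : int) v :
  (forall k, (e %| v 0%R k)%Z) -> (e %| gcd_coords v)%Z.
Proof.
move=> ev; rewrite /gcd_coords; apply: (big_ind (fun g => e %| g)%Z) => // x y ex ey.
by rewrite dvdz_gcd ex ey.
Qed.

Lemma gcd_coordsE v : exists w, v = w *~ gcd_coords v.
Proof.
exists (\row_k divz (v 0 k) (gcd_coords v)); apply/rowP => k.
by rewrite mulrz_coord mxE divzK// gcd_coords_dvd.
Qed.

Lemma gcd_coords_ge0 v : 0 <= gcd_coords v.
Proof. by rewrite /gcd_coords; elim: (index_enum _) => [|k s _]; rewrite ?big_nil ?big_cons. Qed.

Lemma gcd_coords_eq0 v : (gcd_coords v == 0) = (v == 0).
Proof.
apply/eqP/eqP => [g0|->]; first by have [w] := gcd_coordsE v; rewrite g0 mulr0z.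
apply/eqP; rewrite -dvd0z; apply: dvd_gcd_coords => k; rewrite mxE; exact: dvdz0.
Qed.

(** The gcd is itself a factor that can be pulled out of [v], and every such factor divides the
    gcd. *)
Lemma primitive_gcd1 v : primitive v <-> `|gcd_coords v| = 1.
Proof.
split=> [pv|g1 k w vE]; first by have [w] := gcd_coordsE v; exact: pv.
have : (k %| gcd_coords v)%Z.
  by apply: dvd_gcd_coords => j; rewrite vE mulrz_coord dvdz_mull.
rewrite dvdzE; have -> : absz (gcd_coords v) = 1%N.
  by apply/eqP; rewrite -eqz_nat abszE g1.
by rewrite dvdn1 -eqz_nat abszE => /eqP.
Qed.

Lemma primitive_neq0 v : primitive v -> v != 0.
Proof. by move/primitive_gcd1 => g1; rewrite -gcd_coords_eq0 -normr_eq0 g1. Qed.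

Lemma primitive_multiple v : v != 0 ->
  exists g : int, exists u, [/\ primitive u, 0 < g & v = u *~ g].
Proof.
move=> v0; have [u uE] := gcd_coordsE v.
have g0 : gcd_coords v != 0 by rewrite gcd_coords_eq0.
exists (gcd_coords v), u; split=> //; last by rewrite lt_def g0 gcd_coords_ge0.
move=> k w uw.
(* A factor [k] left in the quotient [u] would make [gcd * k] a common divisor of the coordinates of
   [v], so [k] must be a unit. *)
have : (gcd_coords v * k %| gcd_coords v)%Z.
  apply: dvd_gcd_coords => j.
  have -> : v 0 j = w 0 j * (gcd_coords v * k).
    by rewrite {1}uE {1}uw -mulrzA mulrz_coord [k * _]mulrC.
  exact: dvdz_mull.
have := @dvdz_mul2l (gcd_coords v) k 1 g0.
rewrite mulr1 => -> ; rewrite dvdzE dvdn1.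
by rewrite -eqz_nat abszE => /eqP.
Qed.

End GcdCoords.

(** * Cones, fans and finiteness of the lattice points *)

Section Cones.
Variables (R : realType) (n : nat).
Implicit Types (F G sigma rho : set 'rV[R]_n) (m w x y : 'rV[R]_n).

Lemma cone_of_gen l (s : 'I_l -> 'rV[int]_n) (i : 'I_l) (t : R) : 0 <= t ->
  cone_of s (t *: latt R (s i)).
Proof.
move=> t0; exists (fun j => if j == i then t else 0) => [j|]; first by case: ifP.
rewrite (bigD1 i)//= eqxx big1 ?addr0// => j /negbTE ->.
by rewrite scale0r.
Qed.

Lemma cone_ofZ l (s : 'I_l -> 'rV[int]_n) (t : R) x : 0 <= t ->
  cone_of s x -> cone_of s (t *: x).
Proof.
move=> t0 [a a0 ->]; exists (fun i => t * a i) => [i|]; first exact: mulr_ge0.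
by rewrite scaler_sumr; apply: eq_bigr => i _; rewrite scalerA.
Qed.

Lemma cone_of_dot_ge0 l (s : 'I_l -> 'rV[int]_n) y :
  (forall i, 0 <= dot y (latt R (s i))) ->
  forall x, cone_of s x -> 0 <= dot y x.
Proof.
move=> y0 x [a a0 ->]; rewrite dot_sumr sumr_ge0// => i _.
by rewrite dotZr mulr_ge0.
Qed.

Lemma has_dim_exists F : rational_polyhedral F -> exists k, has_dim F k.
Proof.
move=> [l [s ->]].
pose U : {vspace 'rV[R]_n} := <<[seq latt R (s i) | i <- enum 'I_l]>>%VS.
have sU i : latt R (s i) \in U by apply/memv_span/map_f; rewrite mem_enum.
exists (\dim U), U; split=> // [x [a a0 ->]|W sW].
  by apply: memv_suml => i _; rewrite memvZ.
apply/span_subvP => _ /mapP[i _ ->]; apply: sW.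
by rewrite -[latt R _]scale1r; exact: cone_of_gen.
Qed.

(** The kernel of [dot m] contains the span of [F], here the whole space, so [m] is orthogonal to
    itself. Hence a linear function on a maximal cone has only one slope. *)
Lemma has_dim_full F m : has_dim F n ->
  (forall x, F x -> dot m x = 0) -> m = 0.
Proof.
move=> [U [FU minU dimU]] Fm; pose W := lker (linfun (dot m : 'rV[R]_n -> R^o)).
have : (U <= W)%VS by apply: minU => x /Fm mx; rewrite memv_ker lfunE/= mx.
have /eqP -> : (U == fullv)%VS.
  by rewrite eqEdim subvf/= dimvf dimU /dim/= mul1n.
move=> /subvP /(_ m (memvf m)); rewrite memv_ker lfunE/= => mm.
apply/eqP; apply: contraTT mm => m0.
by rewrite (gt_eqF (dotxx_gt0 m0)).
Qed.

(** The span of the face lies in that of [F]; with equal dimensions the spans would coincide and [m]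
    would vanish on [F]. This drives the induction that finds a ray in a cone. *)
Lemma has_dim_face F m k k' : (exists2 x, F x & dot m x != 0) ->
  has_dim F k -> has_dim (F `&` [set x | dot m x = 0]) k' -> (k' < k)%N.
Proof.
move=> [x Fx mx] [U [FU _ <-]] [U' [_ minU' <-]].
have UU' : (U' <= U)%VS by apply: minU' => y [/FU].
rewrite ltn_neqAle dimvS// andbT; apply: contraNN mx => dimU.
have /eqP UE : (U' == U)%VS by rewrite eqEdim UU' (eqP dimU)/=.
pose W := lker (linfun (dot m : 'rV[R]_n -> R^o)).
have /subvP/(_ x) : (U' <= W)%VS.
  by apply: minU' => y [_ my]; rewrite memv_ker lfunE/= my.
by rewrite UE memv_ker lfunE/=; apply; exact: FU.
Qed.

(** Since [ray_gen] is an [xget], a primitive generator has to be produced: take any nonzero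
    generator of the cone and divide it by its gcd. *)
Lemma ray_genP rho : rational_polyhedral rho -> strongly_convex rho ->
  has_dim rho 1 -> primitive (ray_gen rho) /\
    rho = [set x | exists2 t : R, 0 <= t & x = t *: latt R (ray_gen rho)].
Proof.
move=> [l [s rhoE]] sc [U [rhoU minU dimU]].
suff [u [pu uE]] : exists u, primitive u /\
    rho = [set x | exists2 t : R, 0 <= t & x = t *: latt R u].
  exact: (@xgetI _ 0 [set u | primitive u /\
    rho = [set x | exists2 t : R, 0 <= t & x = t *: latt R u]] u).
have rs i t : 0 <= t -> rho (t *: latt R (s i)).
  by move=> t0; rewrite rhoE; exact: cone_of_gen.
have rs1 i : rho (latt R (s i)) by rewrite -[latt R _]scale1r; exact: rs.
have [i0 si0] : exists i0, s i0 != 0.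
  apply/existsP; apply: contraT; rewrite negb_exists => /forallP s0.
  suff : (U <= 0)%VS by move/dimvS; rewrite dimU dimv0.
  apply: minU => x; rewrite rhoE => -[a _ ->]; apply: memv_suml => i _.
  have /eqP -> : latt R (s i) == 0 by rewrite latt_eq0; exact/negbNE/s0.
  by rewrite scaler0 mem0v.
have v0 : latt R (s i0) != 0 by rewrite latt_eq0.
have UE : U = <[latt R (s i0)]>%VS.
  apply/eqP; rewrite eq_sym eqEdim dimU dim_vline v0 andbT -memvE.
  exact: rhoU.
have rho_ge0 x : rho x -> exists2 t, 0 <= t & x = t *: latt R (s i0).
  move=> rx; have := rhoU _ rx; rewrite UE => /vlineP[t xE]; exists t => //.
  (* A negative coefficient would put both the generator and its opposite in [rho], against strong
     convexity. *)
  rewrite leNgt; apply/negP => t0; case/eqP: v0; apply: sc => //.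
  have -> : - latt R (s i0) = (- t^-1) *: x.
    by rewrite xE scalerA mulNr mulVf ?scaleN1r// lt_eqF.
  by rewrite rhoE; apply: cone_ofZ; rewrite -?rhoE// oppr_ge0 invr_le0 ltW.
have [g [u [pu g0 sE]]] := primitive_multiple si0.
have gR : 0 < g%:~R :> R by rewrite ltr0z.
exists u; split => //; apply/seteqP; split=> [x /rho_ge0[t t0 ->]|x [t t0 ->]]/=.
  by exists (t * g%:~R); rewrite ?mulr_ge0 ?(ltW gR)// sE lattMz scalerA.
have -> : t *: latt R u = (t / g%:~R) *: latt R (s i0).
  by rewrite sE lattMz scalerA divfK// gt_eqF.
by apply: rs; rewrite divr_ge0 ?(ltW gR).
Qed.

(** A form nonnegative on the generators is nonnegative on the cone, so it suffices to minimise the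
    ratio over the finitely many nonzero generators. The resulting form vanishes at the minimiser
    and cuts out a face through it. *)
Lemma min_ratio l (s : 'I_l -> 'rV[int]_n) w y : (exists i, s i != 0) ->
  (forall i, s i != 0 -> 0 < dot w (latt R (s i))) ->
  exists2 i, s i != 0 & forall x, cone_of s x ->
    0 <= dot (y - (dot y (latt R (s i)) / dot w (latt R (s i))) *: w) x.
Proof.
move=> [i0 si0] w0.
case: (@arg_minP _ _ _ i0 (fun i => s i != 0)
  (fun i => dot y (latt R (s i)) / dot w (latt R (s i))) si0) => i si imin.
exists i => //; apply: cone_of_dot_ge0 => j; rewrite dotBl dotZl subr_ge0.
have [->|sj] := eqVneq (s j) 0.
  have /eqP -> : latt R (0 : 'rV[int]_n) == 0 by rewrite latt_eq0.
  by rewrite !dot0r mulr0.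
by rewrite -ler_pdivlMr ?w0// imin.
Qed.

End Cones.

(** * Rays inside the cones of a complete fan *)

Section Fan.
Variables (R : realType) (n : nat) (Sigma : set (set 'rV[R]_n)).
Hypothesis hSigma : complete_fan Sigma.
Implicit Types (F G sigma rho : set 'rV[R]_n) (m w x y : 'rV[R]_n).

(** Induction on the dimension. If all generators are multiples of one of them, [F] is already a
    ray; otherwise [min_ratio] gives a proper face that still contains a nonzero generator. *)
Lemma face_has_ray k F w : Sigma F -> has_dim F k -> (exists2 x, F x & x != 0) ->
  (forall x, F x -> x != 0 -> 0 < dot w x) ->
  exists2 rho, fan_cones Sigma 1 rho & rho `<=` F.
Proof.
elim/ltn_ind: k F => k IH F SF dF [x Fx x0] w0.
have [l [s FE]] := fan_rational hSigma SF.
have Fs i : F (latt R (s i)).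
  by rewrite FE -[latt R _]scale1r; exact: cone_of_gen.
have [i0 si0] : exists i0, s i0 != 0.
  apply/existsP; apply: contraNT x0; rewrite negb_exists => /forallP s0.
  move: Fx; rewrite FE => -[a _ ->]; rewrite big1// => i _.
  by have /eqP -> : latt R (s i) == 0;
    rewrite ?scaler0// latt_eq0; exact/negbNE/s0.
have w0s i : s i != 0 -> 0 < dot w (latt R (s i)).
  by move=> si; apply: w0 => //; rewrite latt_eq0.
(* The only possible proportionality factor, found by applying [w]; with it, [w] vanishes on the
   difference [y] below. *)
pose c j := dot w (latt R (s j)) / dot w (latt R (s i0)).
have [/forallP sE|] := boolP [forall j, latt R (s j) == c j *: latt R (s i0)].
  exists F => //; split => //; exists <[latt R (s i0)]>%VS; split => [z|W FW|].
  - rewrite FE => -[a _ ->]; apply: memv_suml => i _.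
    by rewrite (eqP (sE i)) memvZ// memvZ// memv_line.
  - by rewrite -memvE; exact: FW.
  - by rewrite dim_vline latt_eq0 si0.
rewrite negb_forall => /existsP[j]; rewrite -subr_eq0; set y := _ - _ => y0.
have [||i1 si1] := @min_ratio R n _ s w y; [by exists i0|exact: w0s|].
set q := dot y _ / _; set m := y - _ => m_ge0.
have SG : Sigma (F `&` [set z | dot m z = 0]).
  by apply: (fan_face hSigma SF); exists m => // z; rewrite FE; exact: m_ge0.
have [k' dG] := has_dim_exists (fan_rational hSigma SG).
(* The face is proper: if [m] vanished on all generators, [dot y y] would be [q * dot w y], which is
   zero by the choice of [c]. *)
have kk : (k' < k)%N.
  apply: has_dim_face dF dG; apply: contrapT => m0.
  have {}m0 i : dot y (latt R (s i)) = q * dot w (latt R (s i)).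
    apply/eqP; rewrite -subr_eq0 -dotZl -dotBl -/m; apply/negPn/negP => mi.
    by apply: m0; exists (latt R (s i)).
  have := dotxx_gt0 y0; rewrite {2}/y dotBr dotZr (m0 j) (m0 i0) /c.
  by rewrite mulrCA divfK ?subrr ?ltxx// gt_eqF// w0s.
have [||rho rr rG] := IH _ kk _ SG dG.
- exists (latt R (s i1)); rewrite ?latt_eq0//; split => //=.
  rewrite dotBl dotZl divfK ?subrr// gt_eqF// w0s//.
- by move=> z [Fz _]; exact: w0.
- by exists rho => // z /rG[].
Qed.

Lemma fan_ray_gen rho : fan_cones Sigma 1 rho ->
  primitive (ray_gen rho) /\
    rho = [set x | exists2 t : R, 0 <= t & x = t *: latt R (ray_gen rho)].
Proof.
move=> [Sr dr].
exact: ray_genP (fan_rational hSigma Sr) (fan_strongly_convex hSigma Sr) dr.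
Qed.

Lemma fan_ray_gen_in rho : fan_cones Sigma 1 rho -> rho (latt R (ray_gen rho)).
Proof.
by move=> /fan_ray_gen[_ {1}->]; exists 1; rewrite ?scale1r.
Qed.

Lemma finite_fan_cones k : finite_set (fan_cones Sigma k).
Proof. by apply: sub_finite_set (fan_finite hSigma) => rho []. Qed.

(** The minimum is attained along a whole face, which contains a ray of the fan. This moves the
    minimiser from an arbitrary generator to a [ray_gen], where the inequalities defining the
    polytope are available. *)
Lemma ratio_min_on_ray sigma w y : Sigma sigma -> (exists2 x, sigma x & x != 0) ->
  (forall x, sigma x -> x != 0 -> 0 < dot w x) ->
  exists2 rho, fan_cones Sigma 1 rho &
    0 < dot w (latt R (ray_gen rho)) /\
    forall x, sigma x ->
      dot y (latt R (ray_gen rho)) / dot w (latt R (ray_gen rho)) * dot w x <= dot y x.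
Proof.
move=> SF [x Fx x0] w0; have [l [s FE]] := fan_rational hSigma SF.
have Fs i : sigma (latt R (s i)).
  by rewrite FE -[latt R _]scale1r; exact: cone_of_gen.
have ex_s : exists i0, s i0 != 0.
  apply/existsP; apply: contraNT x0; rewrite negb_exists => /forallP s0.
  move: Fx; rewrite FE => -[a _ ->]; rewrite big1// => i _.
  by have /eqP -> : latt R (s i) == 0;
    rewrite ?scaler0// latt_eq0; exact/negbNE/s0.
have w0s i : s i != 0 -> 0 < dot w (latt R (s i)).
  by move=> si; apply: w0 => //; rewrite latt_eq0.
have [i1 si1] := min_ratio y ex_s w0s.
set q := _ / _; set m := y - _ => m_ge0.
have SG : Sigma (sigma `&` [set z | dot m z = 0]).
  by apply: (fan_face hSigma SF); exists m => // z; rewrite FE; exact: m_ge0.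
have [k' dG] := has_dim_exists (fan_rational hSigma SG).
have [||rho rr rG] := face_has_ray (w := w) SG dG.
- exists (latt R (s i1)); rewrite ?latt_eq0//; split => //=.
  by rewrite dotBl dotZl divfK ?subrr// gt_eqF// w0s.
- by move=> z [Fz _]; exact: w0.
have [Gu /eqP mu] := rG _ (fan_ray_gen_in rr).
have wu : 0 < dot w (latt R (ray_gen rho)).
  by apply: w0 => //; rewrite latt_eq0 primitive_neq0//; case: (fan_ray_gen rr).
move: mu; rewrite dotBl dotZl subr_eq0 => /eqP mu.
exists rho => //; split => // z; rewrite FE => /m_ge0.
by rewrite mu mulfK ?gt_eqF// dotBl dotZl subr_ge0.
Qed.

(** * Strict concavity and boundedness of the polytope *)

Section Concave.
Variable phi : 'rV[R]_n -> R.
Hypothesis hconc : strictly_concave Sigma phi.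

(** When all slopes agree at [x], each of them attains the minimum there, so every maximal cone
    contains [x]. The same holds for [- x], and strong convexity concludes. *)
Lemma concave_all_equal_eq0 x :
  (forall sigma tau, fan_cones Sigma n sigma -> fan_cones Sigma n tau ->
     dot (slope phi sigma) x = dot (slope phi tau) x) -> x = 0.
Proof.
case: hconc => _ hex heq xE.
have inall y : (forall sigma tau, fan_cones Sigma n sigma ->
     fan_cones Sigma n tau -> dot (slope phi sigma) y = dot (slope phi tau) y) ->
   forall sigma, fan_cones Sigma n sigma -> sigma y.
  move=> yE sigma Ss; have [tau St ty] := hex y.
  by apply/(heq _ Ss); rewrite ty; exact: yE.
have [sigma Ss _] := hex x.
apply: (fan_strongly_convex hSigma (proj1 Ss)); first exact: inall.
by apply: inall Ss => s t hs ht; rewrite !dotNr (xE s t).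
Qed.

Lemma concave_positive_form sigma : fan_cones Sigma n sigma ->
  exists w, forall x, sigma x -> x != 0 -> 0 < dot w x.
Proof.
move=> Ss; case: (hconc) => hle hex heq.
(* Each summand is nonnegative on [sigma]. If the sum is not positive at [x], all summands vanish
   there, so all slopes agree at [x]. *)
exists (\sum_(tau <- fset_set (fan_cones Sigma n)) (slope phi tau - slope phi sigma)).
move=> x sx; apply: contraNT; rewrite -leNgt dot_suml => sum_le0; apply/eqP.
have phix : phi x = dot (slope phi sigma) x by exact/heq.
have term_ge0 tau : fan_cones Sigma n tau -> 0 <= dot (slope phi tau - slope phi sigma) x.
  by move=> St; rewrite dotBl subr_ge0 -phix; exact: hle.
have mem tau : fan_cones Sigma n tau <-> tau \in fset_set (fan_cones Sigma n).
  by rewrite in_fset_set ?inE//; exact: finite_fan_cones.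
suff slopeE tau : fan_cones Sigma n tau -> dot (slope phi tau) x = phi x.
  by apply: concave_all_equal_eq0 => s t hs ht; rewrite !slopeE.
move=> St; apply/eqP; rewrite phix -subr_eq0 -dotBl eq_le term_ge0// andbT.
apply: le_trans sum_le0; rewrite (big_rem tau)/=; last exact/mem.
rewrite lerDl big_seq sumr_ge0// => t /mem_rem /mem; exact: term_ge0.
Qed.

Lemma polytope_lower_bound (psi : 'rV[R]_n -> R) x :
  exists K, forall m, polytope Sigma psi m -> K <= dot m x.
Proof.
have [->|x0] := eqVneq x 0; first by exists 0 => m _; rewrite dot0r.
case: (hconc) => _ hex heq; have [sigma Ss phix] := hex x.
have sx : sigma x by exact/(heq _ Ss).
have [w w0] := concave_positive_form Ss.
pose K rho := psi (latt R (ray_gen rho)) / dot w (latt R (ray_gen rho)) * dot w x.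
(* The minimising ray depends on [m]; summing absolute values over all rays gives a bound
   independent of [m]. *)
exists (- \sum_(rho <- fset_set (fan_cones Sigma 1)) `|K rho|) => m Pm.
have [rho rr [wu mx]] := ratio_min_on_ray m (proj1 Ss) (ex_intro2 _ _ x sx x0) w0.
apply: le_trans (mx _ sx); apply: (@le_trans _ _ (K rho)).
  rewrite lerNl (le_trans (ler_norm _))// normrN (big_rem rho)/= ?lerDl ?sumr_ge0//.
  by rewrite in_fset_set ?inE//; exact: finite_fan_cones.
rewrite /K ler_pM2r ?w0// ler_pM2r ?invr_gt0//; exact: Pm.
Qed.

(** Lower bounds in the directions [e k] and [- e k] enclose the integer points in a box. *)
Lemma finite_lattice_points (psi : 'rV[R]_n -> R) :
  finite_set (lattice_points Sigma psi).
Proof.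
pose e (k : 'I_n) : 'rV[R]_n := delta_mx 0 k.
have /choice[K1 hK1] k : exists K, forall m, polytope Sigma psi m -> K <= dot m (e k).
  exact: polytope_lower_bound.
have /choice[K2 hK2] k : exists K, forall m, polytope Sigma psi m -> K <= dot m (- e k).
  exact: polytope_lower_bound.
pose N := (\sum_k (Num.truncn (`|K1 k| + `|K2 k|)%R).+1)%N.
have bound (m : 'rV[int]_n) k : lattice_points Sigma psi m -> `|m 0 k| < N%:Z.
  move=> Pm; rewrite -(ltr_int R) intr_norm.
  have /= := hK1 k _ Pm; have /= := hK2 k _ Pm.
  rewrite dotNr dot_delta mxE => m2 m1.
  apply: (@le_lt_trans _ _ (`|K1 k| + `|K2 k|)).
    rewrite ler_norml; apply/andP; split.
      by have := ler_norm (- K1 k); rewrite normrN; have := normr_ge0 (K2 k); lra.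
    by have := ler_norm (- K2 k); rewrite normrN; have := normr_ge0 (K1 k); lra.
  apply: lt_le_trans (truncnS_gt _) _.
  by rewrite ler_nat /N (bigD1 k)//= leq_addr.
(* As [|m 0 k| < N], shifting by [N] encodes [m] as a function into ['I_(N + N)]. *)
apply: (@sub_finite_set _ _ [set \row_k ((f k : nat)%:Z - N%:Z) |
    f in [set: {ffun 'I_n -> 'I_(N + N)}]]); last exact/finite_image.
move=> m Pm.
clearbody N.
have mN k : (absz (m 0%R k + N%:Z)%R < N + N)%N.
  by move: (m 0 k) (bound m k Pm) => a; lia.
exists [ffun k => Ordinal (mN k)] => //; apply/rowP => k; rewrite !mxE ffunE/=.
by move: (m 0 k) (bound m k Pm) => a; lia.
Qed.

End Concave.

(** * Slopes of the integral multiple as lattice points *)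

Section Integral.
Variables (phi : 'rV[R]_n -> R) (r : nat).
Hypotheses (hphi : PL Sigma phi) (hconc : strictly_concave Sigma phi).
Hypotheses (r_gt0 : (0 < r)%N) (hint : integral_PL Sigma (r%:R \*o phi)).

Lemma slopeP (psi : 'rV[R]_n -> R) sigma x : PL Sigma psi -> Sigma sigma ->
  sigma x -> psi x = dot (slope psi sigma) x.
Proof. by move=> [_ lin] /lin ex; move: x; exact: (xgetPex 0 ex). Qed.

Lemma slope_lattice_point sigma : fan_cones Sigma n sigma ->
  exists2 m : 'rV[int]_n, lattice_points Sigma (r%:R \*o phi) m
           & latt R m = r%:R *: slope phi sigma.
Proof.
move=> [Ss ds]; have [m mE] := hint.2 _ (conj Ss ds).
(* Integrality is known for the chosen slope of [r * phi]; uniqueness of slopes on a maximal cone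
   identifies it with [r] times the slope of [phi]. *)
have mlat : latt R m = r%:R *: slope phi sigma.
  apply/eqP; rewrite -subr_eq0 -mE; apply/eqP/(has_dim_full ds) => x sx.
  by rewrite dotBl dotZl -(slopeP hint.1 Ss sx) -(slopeP hphi Ss sx) subrr.
exists m => // rho _; rewrite mlat dotZl/= ler_pM2l ?ltr0n//.
by case: hconc => + _ _; apply.
Qed.

Lemma lattice_points_nonempty : exists m : 'rV[int]_n, lattice_points Sigma (r%:R \*o phi) m.
Proof.
case: (hconc) => _ /(_ 0)[sigma Ss _] _.
by have [m] := slope_lattice_point Ss; exists m.
Qed.

(** Compare the points [r * slope phi sigma] for the maximal cones and cancel [r]. This is what
    makes the covariance definite. *)
Lemma lattice_points_span x :
  (forall m m' : 'rV[int]_n, lattice_points Sigma (r%:R \*o phi) m ->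
     lattice_points Sigma (r%:R \*o phi) m' ->
     dot (latt R m) x = dot (latt R m') x) -> x = 0.
Proof.
move=> xE; apply: (concave_all_equal_eq0 hconc) => sigma tau Ss St.
have [m Pm mE] := slope_lattice_point Ss.
have [m' Pm' mE'] := slope_lattice_point St.
have := xE _ _ Pm Pm'; rewrite mE mE' !dotZl => /mulfI; apply.
by rewrite pnatr_eq0 -lt0n.
Qed.

End Integral.

End Fan.

(** * Directional derivatives *)

Section Derivatives.
Variables (R : realType) (V : normedModType R).
Implicit Types (f g : V -> R) (z v : V) (a b : R).

(** Restricting to the line through [z] makes the one-variable chain rule usable for directional
    derivatives. *)
Lemma is_derive_line f z v a :
  is_derive z v f a <-> is_derive (0 : R) 1 (fun h : R => f (h *: v + z)) a.
Proof.
have E : 'D_v f z = 'D_1 (fun h : R^o => f (h *: v + z)) 0.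
  rewrite /derive; set g1 := fun h => h^-1 *: _; set g2 := fun h => h^-1 *: _.
  suff -> : g1 = g2 by [].
  by apply/funext => h; rewrite /g1 /g2/= addr0 scale0r add0r [_%:A]mulr1.
split=> -[d <-]; split; rewrite ?E//.
  exact: (derivable1P f z v).1 d.
exact: (derivable1P f z v).2 d.
Qed.

Lemma is_derive_add f g z v a b : is_derive z v f a -> is_derive z v g b ->
  is_derive z v (fun y => f y + g y) (a + b).
Proof. exact: is_deriveD. Qed.

Lemma is_derive_opp f z v a : is_derive z v f a ->
  is_derive z v (fun y => - f y) (- a).
Proof. exact: is_deriveN. Qed.

Lemma is_derive_mul f g z v a b : is_derive z v f a -> is_derive z v g b ->
  is_derive z v (fun y => f y * g y) (f z * b + g z * a).
Proof. exact: is_deriveM. Qed.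

Lemma is_derive_inv f z v a : f z != 0 -> is_derive z v f a ->
  is_derive z v (fun y => (f y)^-1) (- (f z) ^- 2 * a).
Proof.
move=> fz [df <-]; split; first exact: derivableV.
by rewrite deriveV.
Qed.

Lemma is_derive_comp (q : R -> R) f z v a : derivable q (f z) 1 ->
  is_derive z v f a ->
  is_derive z v (fun y => q (f y)) ((q^`())%classic (f z) * a).
Proof.
move=> dq /is_derive_line df; apply/is_derive_line.
rewrite derive1E.
apply: (@is_derive1_comp _ q (fun h : R => f (h *: v + z))) => //.
by rewrite scale0r add0r; exact: derivableP.
Qed.

Lemma is_derive_bigsum (I : eqType) (s : seq I) (F : I -> V -> R) (dF : I -> R) z v :
  (forall i, i \in s -> is_derive z v (F i) (dF i)) ->
  is_derive z v (fun y => \sum_(i <- s) F i y) (\sum_(i <- s) dF i).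
Proof.
elim: s => [|i s IH] h.
  rewrite big_nil (_ : (fun _ => _) = cst 0) => [|]; first exact: is_derive_cst.
  by apply/funext => y; rewrite big_nil.
rewrite big_cons (_ : (fun _ => _) = fun y => F i y + \sum_(j <- s) F j y).
  apply: is_derive_add; first by apply: h; rewrite mem_head.
  by apply: IH => j js; apply: h; rewrite in_cons js orbT.
by apply/funext => y; rewrite big_cons.
Qed.

(* Derivatives in logarithmic form [f z * l]: powers multiply [l], products add it. *)
Lemma is_derive_exprz f (m : int) z v a : f z != 0 ->
  is_derive z v f (f z * a) ->
  is_derive z v (fun y => f y ^ m) (f z ^ m * (m%:~R * a)).
Proof.
move=> fz df.
have pos k : is_derive z v (fun y => f y ^+ k) (f z ^+ k * (k%:R * a)).
  elim: k => [|k IH].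
    by rewrite mul0r mulr0; exact: is_derive_cst.
  rewrite (_ : (fun _ => _) = fun y => f y * f y ^+ k); last first.
    by apply/funext => y; rewrite exprS.
  apply: is_derive_eq (is_derive_mul df IH) _.
  by rewrite exprS -natr1; ring.
case: m => k; first exact: pos.
rewrite (_ : (fun _ => _) = fun y => (f y ^+ k.+1)^-1); last first.
  by apply/funext => y; rewrite NegzE exprnN.
apply: is_derive_eq (is_derive_inv _ (pos k.+1)) _; first by rewrite expf_neq0.
rewrite NegzE -exprnN mulrNz.
have := expf_neq0 k.+1 fz; move: (f z ^+ k.+1) => x x0.
by field.
Qed.

Lemma is_derive_bigprod I (s : seq I) (F : I -> V -> R) (dF : I -> R) z v :
  (forall i, is_derive z v (F i) (F i z * dF i)) ->
  is_derive z v (fun y => \prod_(i <- s) F i y)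
    (\prod_(i <- s) F i z * \sum_(i <- s) dF i).
Proof.
move=> h; elim: s => [|i s IH].
  rewrite !big_nil mulr0 (_ : (fun _ => _) = cst 1); first exact: is_derive_cst.
  by apply/funext => y; rewrite big_nil.
rewrite !big_cons (_ : (fun _ => _) = fun y => F i y * \prod_(j <- s) F j y).
  by apply: is_derive_eq (is_derive_mul (h i) IH) _; ring.
by apply/funext => y; rewrite big_cons.
Qed.

End Derivatives.

Lemma is_derive_affine (R : realType) (V : normedModType R) (f : V -> R) (z v : V)
    (a : R) : (forall h : R, f (h *: v + z) = h * a + f z) ->
  is_derive z v f a.
Proof.
move=> fE; apply/is_derive_line; rewrite (_ : (fun _ => _) = fun h => h * a + f z).
  have id_h := @is_derive_id R R^o 0 1.
  have cst_h c := @is_derive_cst R R^o R^o c 0 1.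
  have := is_derive_add (is_derive_mul id_h (cst_h a)) (cst_h (f z)).
  by rewrite mulr0 mulr1 add0r addr0.
exact/funext.
Qed.

(** [L] commutes with the difference quotients, and continuity carries it through the limit. *)
Lemma is_derive_coord (R : realType) (V : normedModType R) (L : V -> R)
    (f : R -> V) (t : R) (a : V) :
  (forall x y, L (x - y) = L x - L y) -> (forall (h : R) x, L (h *: x) = h * L x) ->
  continuous L -> is_derive (t : R^o) 1 f a -> is_derive t 1 (L \o f) (L a).
Proof.
move=> LB LZ cL [df <-].
have cvgL : (fun h => h^-1 *: (((L \o f) \o shift t) (h *: (1 : R)) - (L \o f) t))
    @ (0 : R)^' --> L ('D_1 f t).
  apply: cvg_trans (cvg_comp _ _ df (cL _)); apply: near_eq_cvg; near=> h.
  by rewrite /= LZ LB.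
by split; [apply/cvg_ex; exists (L ('D_1 f t))|exact: cvg_lim cvgL].
Unshelve. all: by end_near. Qed.

(** * Logarithmic coordinates on the torus *)

Section Torus.
Variables (R : realType) (n : nat).
Implicit Types (z v w : Cn R n) (m : 'rV[int]_n) (k : 'I_n).

Definition sqnorm_coord k z : R := z.1 0 k ^+ 2 + z.2 0 k ^+ 2.

(* [dlog_norm z v] and [darg z v] are the vectors of real and imaginary parts of
   [v_k / z_k], i.e. the differentials of [log |z_k|] and [arg z_k] at [z]. *)
Definition dlog_norm z v : 'rV[R]_n :=
  \row_k ((z.1 0 k * v.1 0 k + z.2 0 k * v.2 0 k) / sqnorm_coord k z).

Definition darg z v : 'rV[R]_n :=
  \row_k ((z.1 0 k * v.2 0 k - z.2 0 k * v.1 0 k) / sqnorm_coord k z).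

Lemma sqnorm_coord_gt0 z k : torus z -> 0 < sqnorm_coord k z.
Proof.
move=> /(_ k); rewrite /sqnorm_coord lt_def addr_ge0 ?sqr_ge0// andbT.
apply: contraNN; rewrite paddr_eq0 ?sqr_ge0// !sqrf_eq0 => /andP[/eqP x0 /eqP y0].
by rewrite /Defs.coord eq_complex/= x0 y0 eqxx.
Qed.

(** Replaces complex moduli by integer powers of positive reals, to which the logarithmic derivative
    rules apply. *)
Lemma sqnorm_chiE m z : sqnorm_chi m z = \prod_(k < n) sqnorm_coord k z ^ m 0 k.
Proof.
rewrite /sqnorm_chi /chi.
have normX (x : R[i]) (e : int) : `|x ^ e| = `|x| ^ e.
  by case: e => i; rewrite ?NegzE -?exprnN -?exprnP ?normfV normrX.
rewrite normr_prod -prodrXl (eq_bigr (fun k => (sqnorm_coord k z ^ m 0 k)%:C%C)).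
  by rewrite -rmorph_prod.
move=> k _; rewrite normX exprnP exprzAC -exprnP -add_Re2_Im2.
by rewrite fmorphXz.
Qed.

Lemma sqnorm_chi_gt0 m z : torus z -> 0 < sqnorm_chi m z.
Proof.
by move=> tz; rewrite sqnorm_chiE prodr_gt0// => k _; rewrite exprz_gt0// sqnorm_coord_gt0.
Qed.

Lemma Im_divc z v k : complex.Im (Defs.coord k v / Defs.coord k z) = darg z v 0 k.
Proof. by rewrite /Defs.coord mxE /sqnorm_coord /=; ring. Qed.

Lemma is_derive_re z v k : is_derive z v (fun y : Cn R n => y.1 0 k) (v.1 0 k).
Proof. by apply: is_derive_affine => h; rewrite !mxE. Qed.

Lemma is_derive_im z v k : is_derive z v (fun y : Cn R n => y.2 0 k) (v.2 0 k).
Proof. by apply: is_derive_affine => h; rewrite !mxE. Qed.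

Lemma is_derive_sqnorm_coord z v k : torus z ->
  is_derive z v (sqnorm_coord k) (sqnorm_coord k z * (2 * dlog_norm z v 0 k)).
Proof.
move=> tz; have re := is_derive_re z v k; have im := is_derive_im z v k.
apply: is_derive_eq (is_derive_add (is_derive_mul re re) (is_derive_mul im im)) _.
have := sqnorm_coord_gt0 k tz => /gt_eqF N0; rewrite mxE /=.
by rewrite mulrCA [sqnorm_coord k z * _]mulrC divfK ?N0//; ring.
Qed.

Lemma is_derive_sqnorm_chi z v m : torus z ->
  is_derive z v (sqnorm_chi m)
    (sqnorm_chi m z * (2 * dot (latt R m) (dlog_norm z v))).
Proof.
move=> tz; have d k := is_derive_exprz (m 0 k)
  (lt0r_neq0 (sqnorm_coord_gt0 k tz)) (is_derive_sqnorm_coord v k tz).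
have := is_derive_bigprod (index_enum 'I_n) d.
rewrite -sqnorm_chiE (_ : (fun y => \prod_(k <- _) _) = sqnorm_chi m); last first.
  by apply/funext => y; rewrite sqnorm_chiE.
move=> h; apply: is_derive_eq h _; congr (_ * _).
by rewrite /dot mulr_sumr; apply: eq_bigr => k _; rewrite [latt R m 0 k]mxE; ring.
Qed.

(* The second derivative of [arg z_k], symmetric in [v] and [w]: [d arg] is closed. *)
Lemma is_derive_darg z v w k : torus z -> is_derive z v (fun y => darg y w 0 k)
  ((v.1 0 k * w.2 0 k + v.2 0 k * w.1 0 k) *
     (z.2 0 k ^+ 2 - z.1 0 k ^+ 2) / sqnorm_coord k z ^+ 2
   + (v.1 0 k * w.1 0 k - v.2 0 k * w.2 0 k) *
     (2 * z.1 0 k * z.2 0 k) / sqnorm_coord k z ^+ 2).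
Proof.
move=> tz; have N0 := lt0r_neq0 (sqnorm_coord_gt0 k tz).
have re := is_derive_re z v k; have im := is_derive_im z v k.
have cst_d (c : R) : is_derive z v (fun=> c) 0 by exact: is_derive_cst.
have num := is_derive_add (is_derive_mul re (cst_d (w.2 0 k)))
  (is_derive_opp (is_derive_mul im (cst_d (w.1 0 k)))).
have := is_derive_mul num (is_derive_inv N0 (is_derive_sqnorm_coord v k tz)).
rewrite (_ : (fun y => _ * _) = fun y => darg y w 0 k); last first.
  by apply/funext => y; rewrite mxE.
move=> h; apply: is_derive_eq h _; rewrite mxE /=.
move: N0; rewrite /sqnorm_coord => N0.
by field.
Qed.

(** Take [v_k = z_k (a_k + i b_k)]. Thus [dlog_norm] and [darg] are coordinates on the tangent
    space. *)
Lemma torus_tangent z (a b : 'rV[R]_n) : torus z ->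
  exists v, dlog_norm z v = a /\ darg z v = b.
Proof.
move=> tz; exists (\row_k (z.1 0 k * a 0 k - z.2 0 k * b 0 k),
                   \row_k (z.1 0 k * b 0 k + z.2 0 k * a 0 k)).
split; apply/rowP => k; rewrite !mxE/=; apply: canLR (mulfK _) _;
  rewrite ?lt0r_neq0 ?sqnorm_coord_gt0// /sqnorm_coord; ring.
Qed.

End Torus.

(** * The moment map and the symplectic form *)

Section MomentMap.
Variables (R : realType) (n : nat) (Sigma : set (set 'rV[R]_n)) (psi : 'rV[R]_n -> R).
Local Notation A := (lattice_points Sigma psi).
Hypothesis finA : finite_set A.
Hypothesis A_neq0 : exists m : 'rV[int]_n, A m.
Hypothesis A_span : forall x : 'rV[R]_n, (forall m m' : 'rV[int]_n, A m -> A m' ->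
  dot (latt R m) x = dot (latt R m') x) -> x = 0.
Implicit Types (z v w : Cn R n) (m : 'rV[int]_n) (k : 'I_n) (a b u : 'rV[R]_n).

Definition total_weight z : R := \sum_(m <- fset_set A) sqnorm_chi m z.

(** On the torus this is an expectation, for the probability weights proportional to [|chi^m|^2]. *)
Definition avg z (f : 'rV[int]_n -> R) : R :=
  (total_weight z)^-1 * \sum_(m <- fset_set A) sqnorm_chi m z * f m.

(* The covariance of the linear forms [a] and [b] on the weighted lattice points;
   up to a factor 2 it is the Jacobian of [mu] in the coordinates [log |z_k|]. *)
Definition cov z a b : R :=
  avg z (fun m => dot (latt R m) a * dot (latt R m) b)
  - avg z (fun m => dot (latt R m) a) * avg z (fun m => dot (latt R m) b).

Lemma mem_latticeP m : reflect (A m) (m \in fset_set A).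
Proof. by rewrite in_fset_set//; apply: (iffP idP) => [/set_mem|/mem_set]. Qed.

Lemma total_weight_gt0 z : torus z -> 0 < total_weight z.
Proof.
move=> tz; have [m /mem_latticeP Am] := A_neq0.
rewrite /total_weight (big_rem m)//= ltr_pwDl ?sqnorm_chi_gt0//.
by rewrite sumr_ge0// => m' _; rewrite ltW// sqnorm_chi_gt0.
Qed.

Lemma avgD z f g : avg z (fun m => f m + g m) = avg z f + avg z g.
Proof.
rewrite /avg -mulrDr -big_split/=; congr (_ * _).
by apply: eq_bigr => m _; rewrite mulrDr.
Qed.

Lemma avgZ z c f : avg z (fun m => c * f m) = c * avg z f.
Proof.
by rewrite /avg mulrCA; congr (_ * _); rewrite mulr_sumr; apply: eq_bigr => m _; rewrite mulrCA.
Qed.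

Lemma avg_cst z c : torus z -> avg z (fun=> c) = c.
Proof.
by move=> tz; rewrite /avg -mulr_suml mulKf// lt0r_neq0// total_weight_gt0.
Qed.

Lemma eq_avg z f g : f =1 g -> avg z f = avg z g.
Proof. by move=> fg; congr (_ * _); apply: eq_bigr => m _; rewrite fg. Qed.

Lemma avg_ge0 z f : torus z -> (forall m, A m -> 0 <= f m) -> 0 <= avg z f.
Proof.
move=> tz f0; rewrite /avg mulr_ge0 ?invr_ge0 ?(ltW (total_weight_gt0 tz))//.
rewrite big_seq sumr_ge0// => m /mem_latticeP Am.
by rewrite mulr_ge0 ?f0// ltW// sqnorm_chi_gt0.
Qed.

Lemma avg_eq0 z f : torus z -> (forall m, A m -> 0 <= f m) -> avg z f = 0 ->
  forall m, A m -> f m = 0.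
Proof.
move=> tz f0 /eqP; rewrite /avg mulf_eq0 invr_eq0 gt_eqF ?total_weight_gt0//=.
move=> S0 m Am; have W m' := sqnorm_chi_gt0 m' tz.
move: S0; rewrite big_seq psumr_eq0 => [/allP/(_ m)|m' /mem_latticeP Am'].
  have mA : m \in fset_set A by exact/mem_latticeP.
  by rewrite mA mulf_eq0 gt_eqF//= => /(_ isT)/eqP.
by rewrite mulr_ge0 ?f0// ltW.
Qed.

Lemma dot_mu z u : dot (mu Sigma psi z) u = avg z (fun m => dot (latt R m) u).
Proof.
rewrite /mu !fsbig_finite// dotZl; congr (_ * _); rewrite dot_suml.
by apply: eq_bigr => m _; rewrite dotZl.
Qed.

Lemma cov_sym z a b : cov z a b = cov z b a.
Proof.
by rewrite /cov [X in _ - X]mulrC; congr (_ - _); apply: eq_avg => m; rewrite mulrC.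
Qed.

Lemma cov_linear z a t b b' : cov z a (t *: b + b') = t * cov z a b + cov z a b'.
Proof.
rewrite /cov (@eq_avg z _ (fun m => t * (dot (latt R m) a * dot (latt R m) b) +
  dot (latt R m) a * dot (latt R m) b')) => [|m].
  rewrite avgD avgZ (@eq_avg z (fun m => dot (latt R m) (t *: b + b'))
    (fun m => t * dot (latt R m) b + dot (latt R m) b')) => [|m].
    by rewrite avgD avgZ; ring.
  by rewrite dotDr dotZr.
by rewrite dotDr dotZr; ring.
Qed.

Lemma cov0r z a : cov z a 0 = 0.
Proof. by have := cov_linear z a (-1) 0 0; rewrite scaler0 addr0 mulN1r addNr. Qed.

Lemma cov_sumr I (s : seq I) (t : I -> R) (F : I -> 'rV[R]_n) z a :
  cov z a (\sum_(i <- s) t i *: F i) = \sum_(i <- s) t i * cov z a (F i).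
Proof.
elim: s => [|i s IH]; first by rewrite !big_nil cov0r.
by rewrite !big_cons cov_linear IH.
Qed.

(** [cov z a a] is the variance of [dot (latt R m) a]. All weights are positive, so zero variance
    makes this form constant on the lattice points, and [A_span] applies. *)
Lemma cov_definite z a : torus z -> cov z a a = 0 -> a = 0.
Proof.
move=> tz caa; set e := avg z (fun m => dot (latt R m) a).
have var0 : avg z (fun m => (dot (latt R m) a - e) ^+ 2) = 0.
  rewrite (@eq_avg z _ (fun m => dot (latt R m) a * dot (latt R m) a +
    ((- 2 * e) * dot (latt R m) a + e ^+ 2))) => [|m]; last by ring.
  rewrite !avgD avgZ avg_cst// -[RHS]caa /cov -/e; ring.
have mE m : A m -> dot (latt R m) a = e.
  move=> Am; have /eqP := avg_eq0 tz (fun m _ => sqr_ge0 _) var0 Am.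
  by rewrite sqrf_eq0 subr_eq0 => /eqP.
by apply: A_span => m m' /mE-> /mE->.
Qed.

(** Each weight has logarithmic derivative [2 * dot (latt R m) (dlog_norm z v)]; differentiating the
    normalised sum yields twice a covariance. *)
Lemma is_derive_avg z v f : torus z -> is_derive z v (fun y => avg y f)
  (2 * (avg z (fun m => f m * dot (latt R m) (dlog_norm z v)) -
        avg z f * avg z (fun m => dot (latt R m) (dlog_norm z v)))).
Proof.
move=> tz; have N0 := lt0r_neq0 (total_weight_gt0 tz).
have cst_d (c : R) : is_derive z v (fun=> c) 0 by exact: is_derive_cst.
have dW m := is_derive_sqnorm_chi v m tz.
have dN := is_derive_inv N0 (is_derive_bigsum (s := fset_set A) (fun m _ => dW m)).
have dS := is_derive_bigsum (s := fset_set A) (fun m _ => is_derive_mul (dW m) (cst_d (f m))).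
have h := is_derive_mul dN dS; apply: is_derive_eq h _.
rewrite /avg.
set l := fun m => dot (latt R m) (dlog_norm z v).
rewrite (eq_bigr (fun m => 2 * (sqnorm_chi m z * (f m * l m)))); last first.
  by move=> m _; rewrite /l; ring.
rewrite [X in _ + _ * (_ * X)](eq_bigr (fun m => 2 * (sqnorm_chi m z * l m))); last first.
  by move=> m _; rewrite /l; ring.
rewrite -!mulr_sumr.
move: N0; set N := total_weight z; move=> N0.
by field.
Qed.

Lemma is_derive_dot_mu z v u : torus z ->
  is_derive z v (fun y => dot (mu Sigma psi y) u) (2 * cov z u (dlog_norm z v)).
Proof.
move=> tz; rewrite (_ : (fun y => _) = fun y => avg y (fun m => dot (latt R m) u)).
  exact: is_derive_avg.
by apply/funext => y; rewrite dot_mu.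
Qed.

(** Subtracting the conjugate leaves [2 i] times the imaginary part of [v_k / z_k], and the
    prefactor [- i / 2] turns this into [darg]. *)
Lemma thetaE z v : theta Sigma psi z v = dot (mu Sigma psi z) (darg z v).
Proof.
rewrite /theta /dot.
rewrite (eq_bigr (fun k => (mu Sigma psi z 0 k * darg z v 0 k)%:C%C * (2 * 'i%C))).
  rewrite -mulr_suml -rmorph_sum.
  move: (\sum_k _) => x.
  have -> : - ('i%C / 2) * (x%:C%C * (2 * 'i%C)) = - 'i%C ^+ 2 * x%:C%C :> R[i].
    by field.
  by rewrite sqr_i opprK mul1r.
move=> k _; rewrite -dot_delta dot_mu -Im_divc.
have -> : (Defs.coord k v / Defs.coord k z - (Defs.coord k v)^*%C / (Defs.coord k z)^*%C)
   = 2 * (complex.Im (Defs.coord k v / Defs.coord k z))%:C%C * 'i%C.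
  by rewrite -subcJ rmorphM fmorphV.
have -> : (\sum_(m \in A) (m 0 k)%:~R * sqnorm_chi m z) /
    (\sum_(m \in A) sqnorm_chi m z) = avg z (fun m => dot (latt R m) (delta_mx 0 k)).
  rewrite !fsbig_finite// /avg mulrC; congr (_ * _); apply: eq_bigr => m _.
  by rewrite dot_delta mxE mulrC.
rewrite [RHS in _ = RHS](_ : _ = (avg z (fun m => dot (latt R m) (delta_mx 0 k)))%:C%C *
  (complex.Im (Defs.coord k v / Defs.coord k z))%:C%C * (2 * 'i%C)); last by rewrite rmorphM.
by ring.
Qed.

Lemma omegaE z v w : torus z -> omega Sigma psi z v w =
  2 * cov z (darg z w) (dlog_norm z v) - 2 * cov z (darg z v) (dlog_norm z w).
Proof.
move=> tz.
have d v' w' : is_derive z v' (fun y => theta Sigma psi y w')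
    (2 * cov z (darg z w') (dlog_norm z v') +
     \sum_k mu Sigma psi z 0 k * 'D_v' (fun y => darg y w' 0 k) z).
  have dk k : is_derive z v' (fun y => dot (mu Sigma psi y) (delta_mx 0 k) * darg y w' 0 k)
     (dot (mu Sigma psi z) (delta_mx 0 k) * 'D_v' (fun y => darg y w' 0 k) z +
      darg z w' 0 k * (2 * cov z (delta_mx 0 k) (dlog_norm z v'))).
    apply: is_derive_mul; first exact: is_derive_dot_mu.
    by apply: derivableP; case: (is_derive_darg v' w' k tz).
  have h := is_derive_bigsum (s := index_enum 'I_n) (fun k _ => dk k).
  rewrite (_ : (fun y => theta _ _ _ _) = fun y => \sum_k
    dot (mu Sigma psi y) (delta_mx 0 k) * darg y w' 0 k); last first.
    by apply/funext => y; rewrite thetaE; apply: eq_bigr => k _; rewrite dot_delta.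
  apply: is_derive_eq h _; rewrite big_split/= addrC; congr (_ + _).
    rewrite [darg z w' in RHS]row_sum_delta [cov z _ _ in RHS]cov_sym cov_sumr mulr_sumr.
    by apply: eq_bigr => k _; rewrite cov_sym; ring.
  by apply: eq_bigr => k _; rewrite dot_delta.
rewrite /omega /ext_d !derive_val.
(* The product rule also differentiates [darg]; these terms are symmetric in [v] and [w] and cancel,
   leaving the wedge of [d mu_k] with [d arg z_k]. *)
have -> : \sum_k mu Sigma psi z 0 k * 'D_v (fun y => darg y w 0 k) z =
          \sum_k mu Sigma psi z 0 k * 'D_w (fun y => darg y v 0 k) z.
  apply: eq_bigr => k _; congr (_ * _).
  have [_ ->] := is_derive_darg v w k tz; have [_ ->] := is_derive_darg w v k tz.
  by congr (_ * _ / _ + _ * _ / _); ring.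
by ring.
Qed.

End MomentMap.

(** * The Hamiltonian vector field *)

Lemma derivable_q (R : realType) (e x : R) : 0 < x < e -> derivable (q_ e) x 1.
Proof.
move=> /andP[x0 xe]; have e0 : 0 < e by exact: lt_trans xe.
have id_d : is_derive (x : R^o) (1 : R^o) (id : R^o -> R^o) 1 by exact: is_derive_id.
have cst_d (c : R) : is_derive (x : R^o) (1 : R^o) (fun=> c) 0 by exact: is_derive_cst.
have den : e ^+ 2 * (e ^+ 2 + - (x * x)) != 0.
  rewrite mulf_neq0 ?expf_neq0 ?gt_eqF// subr_gt0 -expr2 ltr_pXn2r//.
    by rewrite nnegrE ltW.
  by rewrite nnegrE ltW.
have ex2 := is_derive_mul id_d id_d.
have dden := is_derive_mul (cst_d (e ^+ 2))
  (is_derive_add (cst_d (e ^+ 2)) (is_derive_opp ex2)).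
have dinv := @is_derive_inv R R^o (fun y => e ^+ 2 * (e ^+ 2 + - (y * y))) x 1 _ den dden.
have frac := is_derive_opp (is_derive_mul ex2 dinv).
have [dexp _] := @is_derive_comp R R^o expR
  (fun y => - (y * y * (e ^+ 2 * (e ^+ 2 + - (y * y)))^-1)) x 1 _ (@derivable_expR R _) frac.
(* Near a point below [e] the conditional in [q_] always takes its exponential branch. *)
apply: near_eq_derivable dexp; near=> y.
have ye : y < e by near: y; exact: lt_nbhsl.
by rewrite /q_ ye expr2.
Unshelve. all: by end_near. Qed.

Section Hamiltonian.
Variables (R : realType) (n : nat) (Sigma : set (set 'rV[R]_n)) (psi : 'rV[R]_n -> R).
Hypothesis hSigma : complete_fan Sigma.
Local Notation A := (lattice_points Sigma psi).
Local Notation avg := (avg Sigma psi).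
Local Notation cov := (cov Sigma psi).
Hypothesis finA : finite_set A.
Hypothesis A_neq0 : exists m : 'rV[int]_n, A m.
Hypothesis A_span : forall x : 'rV[R]_n, (forall m m' : 'rV[int]_n, A m -> A m' ->
  dot (latt R m) x = dot (latt R m') x) -> x = 0.
Variables (eps : set 'rV[R]_n -> R) (sigma : set 'rV[R]_n).
Hypothesis Ssigma : Sigma sigma.
Implicit Types (z v w : Cn R n) (m : 'rV[int]_n) (k : 'I_n) (rho tau : set 'rV[R]_n).

(** A proper face of a ray has smaller dimension. Hence membership in [U_] of a ray is a condition
    on that ray alone. *)
Lemma rays_of_ray rho tau : fan_cones Sigma 1 rho -> rays_of rho tau -> tau = rho.
Proof.
move=> [_ drho] [[m _ tauE] dtau].
have [mrho|mrho] := pselect (forall x, rho x -> dot m x = 0).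
  by rewrite tauE; apply/seteqP; split=> [x []//|x rx]; split; [|exact: mrho].
have : (1 < 1)%N.
  apply: has_dim_face drho (_ : has_dim (rho `&` [set x | dot m x = 0]) 1).
    apply: contrapT => nex; apply: mrho => x rx; apply: contrapT => mx.
    by apply: nex; exists x => //; apply/eqP.
  by rewrite -tauE.
by rewrite ltnn.
Qed.

Lemma rays_of_fan tau : rays_of sigma tau -> fan_cones Sigma 1 tau.
Proof. by move=> [ft dt]; split => //; exact: fan_face ft. Qed.

(** A positively weighted mean of nonnegative numbers vanishes only if all of them do. Then [u]
    would be constant on the lattice points, hence zero, but it is primitive. *)
Lemma r_mu_gt0 z rho : torus z -> fan_cones Sigma 1 rho ->
  0 < r_ psi rho (mu Sigma psi z).
Proof.
move=> tz rr; set u := latt R (ray_gen rho).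
have rE : r_ psi rho (mu Sigma psi z) = avg z (fun m => dot (latt R m) u + - psi u).
  by rewrite /r_ dot_mu// avgD avg_cst.
have f_ge0 m : A m -> 0 <= dot (latt R m) u + - psi u.
  by move=> /(_ _ rr); rewrite subr_ge0.
rewrite lt_def rE avg_ge0// andbT; apply/eqP => /(avg_eq0 finA A_neq0 tz f_ge0) f0.
have : u = 0.
  by apply: A_span => m m' /f0/eqP + /f0/eqP; rewrite !subr_eq0 => /eqP-> /eqP->.
by apply/eqP; rewrite latt_eq0 primitive_neq0//; case: (fan_ray_gen hSigma rr).
Qed.

Lemma is_derive_r_mu z v rho : torus z ->
  is_derive z v (fun y => r_ psi rho (mu Sigma psi y))
    (2 * cov z (latt R (ray_gen rho)) (dlog_norm z v)).
Proof.
move=> tz.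
have cst_d (c : R) : is_derive z v (fun=> c) 0 by exact: is_derive_cst.
have := is_derive_add (is_derive_dot_mu finA A_neq0 v (latt R (ray_gen rho)) tz)
  (cst_d (- psi (latt R (ray_gen rho)))).
by rewrite addr0.
Qed.

Variables (d : set 'rV[R]_n -> rat) (z : Cn R n).
Hypothesis Bz : B_ Sigma psi eps sigma d z.

Lemma B_sub_S : S_ Sigma psi eps sigma z.
Proof. by case: Bz => Sz _; apply: interior_subset Sz. Qed.

Lemma B_torus : torus z.
Proof. by have [[]] := B_sub_S. Qed.

Lemma is_derive_hamiltonian v : is_derive z v (hamiltonian Sigma psi eps)
  (- (2 * cov z (c_ sigma d) (dlog_norm z v))).
Proof.
have tz := B_torus; have [Sz dz] := Bz.
have finS := finite_fan_cones hSigma 1.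
have term rho : rho \in fset_set (fan_cones Sigma 1) ->
    is_derive z v (fun y => q_ (eps rho) (r_ psi rho (mu Sigma psi y)))
    ((if rho \in rays_of sigma then - ratr (d rho) else 0) *
      (2 * cov z (latt R (ray_gen rho)) (dlog_norm z v))).
  rewrite in_fset_set// => /set_mem rr; case: ifPn => [/set_mem sr|/negP nsr].
    rewrite -dz//; apply: is_derive_comp; last exact: is_derive_r_mu.
    by apply: derivable_q; have [[_ +] _] := B_sub_S; apply.
  have cst_d : is_derive z v (fun=> 0 : R) 0 by exact: is_derive_cst.
  (* Because [z] is interior to [S_], nearby points avoid [U_] of this ray. As [r_] is positive
     there, it is at least [eps rho], so the term is locally zero. *)
  rewrite mul0r; apply: (near_eq_is_derive _ cst_d).
  move: Sz; rewrite /interior; apply: filterS => y [[ty _] /(_ rho)].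
  have nU : (fan_cones Sigma 1 `\` rays_of sigma) rho.
    by split => //; move/mem_set.
  move=> /(_ nU) nUy; rewrite /q_ ifF//; apply/negP => lt_eps; apply: nUy; split => //.
  by move=> tau /(rays_of_ray rr) ->; rewrite r_mu_gt0.
(* Extending [d] by zero to all rays of the fan matches the index set of the Hamiltonian. *)
have cE : c_ sigma d = \sum_(rho <- fset_set (fan_cones Sigma 1))
    (if rho \in rays_of sigma then ratr (d rho) else 0) *: latt R (ray_gen rho).
  rewrite -fsbig_finite// /c_ -(fsbig_widen (rays_of sigma)) => [|rho /rays_of_fan//|].
    by apply: eq_fsbigr => rho ->.
  by move=> rho [_ nsr]; rewrite /= ifF ?scale0r//; apply/negP => /set_mem.
have := is_derive_bigsum term.
rewrite (_ : (fun y => _) = hamiltonian Sigma psi eps) => [h|]; last first.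
  by apply/funext => y; rewrite /hamiltonian fsbig_finite.
apply: is_derive_eq h _; rewrite cE cov_sym cov_sumr mulr_sumr -sumrN.
by apply: eq_bigr => rho _; rewrite cov_sym; case: ifP => _; ring.
Qed.

Lemma hamiltonian_flow_direction (X : Cn R n -> Cn R n) (c : 'rV[int]_n) :
  c_ sigma d = latt R c ->
  hamiltonian_vf Sigma psi (hamiltonian Sigma psi eps) X ->
  dlog_norm z (X z) = 0 /\ darg z (X z) = - latt R c.
Proof.
move=> cE hX; have tz := B_torus.
(* The defining equation of [X], tested on the tangent vector with logarithmic coordinates [a] and
   [b]. *)
have eqn (a b : 'rV[R]_n) : cov z b (dlog_norm z (X z)) - cov z (darg z (X z)) a =
    cov z (latt R c) a.
  have [v [va vb]] := torus_tangent a b tz.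
  have := hX z tz v; rewrite omegaE// va vb -cE.
  have [_ ->] := is_derive_hamiltonian v; rewrite va opprK => h; lra.
have p0 : dlog_norm z (X z) = 0.
  apply: (cov_definite finA A_neq0 A_span tz).
  (* Testing with [a = 0] and [b] the radial part of [X] isolates the variance of that part. *)
  have := eqn 0 (dlog_norm z (X z)); rewrite !cov0r subr0; exact.
split => //; apply/eqP; rewrite -addr_eq0; apply/eqP.
apply: (cov_definite finA A_neq0 A_span tz).
(* Testing with the sum of the angular part and [c] shows that this sum has zero variance. *)
set a := _ + _; have := eqn a 0; rewrite p0 cov0r sub0r => h.
have -> : cov z a a = cov z a (1 *: darg z (X z) + latt R c) by rewrite scale1r.
by rewrite cov_linear mul1r !(cov_sym _ _ _ a) -h addrN.
Qed.

End Hamiltonian.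

(** * Periods of the orbits *)

(** Rotating [(x, y)] back by the angle [c * t] gives two functions with zero derivative; evaluating
    them at [0] and solving with [cos^2 + sin^2 = 1] recovers [x] and [y]. *)
Lemma rotation_flow (R : realType) (c : R) (x y : R -> R) :
  (forall t, is_derive (t : R^o) (1 : R^o) x (c * y t)) ->
  (forall t, is_derive (t : R^o) (1 : R^o) y (- (c * x t))) ->
  forall t, x t = x 0 * cos (c * t) + y 0 * sin (c * t) /\
            y t = y 0 * cos (c * t) - x 0 * sin (c * t).
Proof.
move=> dx dy t.
have dlin s : is_derive (s : R^o) (1 : R^o) (fun u : R => c * u) c.
  have := is_derive_mul (@is_derive_cst R R^o R^o c s 1) (@is_derive_id R R^o s 1).
  by rewrite mulr1 mulr0 addr0.
have dcos s : is_derive (s : R^o) (1 : R^o) (fun u : R => cos (c * u)) (- sin (c * s) * c).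
  exact: (@is_derive1_comp _ cos (fun u => c * u)).
have dsin s : is_derive (s : R^o) (1 : R^o) (fun u : R => sin (c * u)) (cos (c * s) * c).
  exact: (@is_derive1_comp _ sin (fun u => c * u)).
have A s : is_derive (s : R^o) (1 : R^o)
    (fun u : R => x u * cos (c * u) + - (y u * sin (c * u))) 0.
  have := is_derive_add (is_derive_mul (dx s) (dcos s))
    (is_derive_opp (is_derive_mul (dy s) (dsin s))).
  by move=> h; apply: is_derive_eq h _; ring.
have B s : is_derive (s : R^o) (1 : R^o)
    (fun u : R => x u * sin (c * u) + y u * cos (c * u)) 0.
  have := is_derive_add (is_derive_mul (dx s) (dsin s))
    (is_derive_mul (dy s) (dcos s)).
  by move=> h; apply: is_derive_eq h _; ring.
have := is_derive_0_is_cst t 0 A; have := is_derive_0_is_cst t 0 B.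
rewrite /= !mulr0 sin0 cos0 !mulr0 !mulr1 oppr0 add0r addr0.
have := cos2Dsin2 (c * t).
move: (cos _) (sin _) (x t) (y t) => C S xt yt CS <- <-.
by split; rewrite -[LHS]mulr1 -CS; ring.
Qed.

Lemma cos_eq1P (R : realType) (a : R) :
  cos a = 1 <-> exists j : int, a = 2 * pi * j%:~R.
Proof.
have pi2 : 0 < 2 * pi :> R by rewrite mulr_gt0// pi_gt0.
have cosD (j : int) x : cos (x + 2 * pi * j%:~R) = cos x :> R.
  have per (i : nat) y : cos (y + 2 * pi * i%:R) = cos y :> R.
    rewrite -[RHS](periodicn (@cosD2pi R) i); congr (cos (_ + _)).
    by rewrite -[(pi *+ 2) *+ i]mulr_natr -[pi *+ 2]mulr_natl.
  case: j => i; first exact: per.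
  rewrite NegzE mulrNz mulrN -[LHS](per i.+1); congr (cos _).
  by rewrite subrK.
split=> [cosa|[j ->]]; last by rewrite -[_ * _]add0r cosD cos0.
(* Reduce to [b] in [[0, 2 pi)]. There [cos b = 1 - 2 sin^2 (b / 2)], and [sin (b / 2)] is positive
   unless [b = 0]. *)
set j := Num.floor (a / (2 * pi)); exists j; apply/eqP; rewrite -subr_eq0.
set b := a - _; have cosb : cos b = 1 by rewrite -cosa -(cosD j b) subrK.
have /andP[j_le j_gt] := floor_itv (a / (2 * pi)).
have b_ge0 : 0 <= b by rewrite subr_ge0 mulrC -ler_pdivlMr.
have b_lt : b < 2 * pi.
  rewrite ltrBlDl -[X in _ + X]mulr1 -mulrDr mulrC -ltr_pdivrMr//.
  by move: j_gt; rewrite intrD.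
rewrite eq_le b_ge0 andbT leNgt; apply/negP => b_gt0.
have : 0 < sin (b / 2) by apply: sin_gt0_pi; apply/andP; split; lra.
move: cosb; rewrite [b in cos b](_ : b = (b / 2) *+ 2); last by rewrite -mulr_natr; lra.
rewrite cos_mulr2n cos2sin2; move: (sin _) => x; nra.
Qed.

Lemma is_derive_re_path (R : realType) (n : nat) (gamma : R -> Cn R n) t v k :
  is_derive (t : R^o) 1 gamma v ->
  is_derive (t : R^o) (1 : R^o) (fun s => (gamma s).1 0 k) (v.1 0 k).
Proof.
apply: (is_derive_coord (L := fun z : Cn R n => z.1 0 k)) => [x y|h x|z].
- by rewrite !mxE.
- by rewrite mxE.
- apply: (@continuous_comp _ _ _ fst (fun M : 'rV[R]_n => M 0 k)).
    by case: z => x y; exact: cvg_fst.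
  exact: coord_continuous.
Qed.

Lemma is_derive_im_path (R : realType) (n : nat) (gamma : R -> Cn R n) t v k :
  is_derive (t : R^o) 1 gamma v ->
  is_derive (t : R^o) (1 : R^o) (fun s => (gamma s).2 0 k) (v.2 0 k).
Proof.
apply: (is_derive_coord (L := fun z : Cn R n => z.2 0 k)) => [x y|h x|z].
- by rewrite !mxE.
- by rewrite mxE.
- apply: (@continuous_comp _ _ _ snd (fun M : 'rV[R]_n => M 0 k)).
    by case: z => x y; exact: cvg_snd.
  exact: coord_continuous.
Qed.

Section Period.
Variables (R : realType) (n : nat) (c : 'rV[int]_n) (gamma : R -> Cn R n).
Hypothesis gamma_torus : forall t, torus (gamma t).
Hypothesis gamma_rot : forall t k, 
  (gamma t).1 0 k = (gamma 0).1 0 k * cos ((c 0 k)%:~R * t) +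
                    (gamma 0).2 0 k * sin ((c 0 k)%:~R * t) /\
  (gamma t).2 0 k = (gamma 0).2 0 k * cos ((c 0 k)%:~R * t) -
                    (gamma 0).1 0 k * sin ((c 0 k)%:~R * t).

(** A period must turn every coordinate by a multiple of [2 pi]. Bezout combines these conditions
    into one on the gcd, which in turn implies each of them. *)
Lemma gamma_period T : (forall t, gamma (t + T) = gamma t) <->
  exists j : int, (gcd_coords c)%:~R * T = 2 * pi * j%:~R.
Proof.
split=> [per|[j gT] t].
  have cT k : exists j : int, (c 0 k)%:~R * T = 2 * pi * j%:~R.
    apply/cos_eq1P; have := per 0; rewrite add0r => g0.
    have [h1 h2] := gamma_rot T k; move: h1 h2; rewrite g0 => h1 h2.
    (* Weighting the two rotation equations by [x] and [y] and adding gives [|z_k|^2 = |z_k|^2 cos],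
       with [z_k] nonzero. *)
    have := sqnorm_coord_gt0 k (gamma_torus 0) => /lt0r_neq0/mulfI; apply.
    rewrite mulr1 /sqnorm_coord; move: h1 h2.
    move: (gamma 0).1 (gamma 0).2 => x y; move: (x 0 k) (y 0 k) (cos _) (sin _).
    move=> {}x {}y C S h1 h2.
    have e1 : x * x = x * (x * C + y * S) by rewrite -h1.
    have e2 : y * y = y * (y * C - x * S) by rewrite -h2.
    by lra.
  rewrite /gcd_coords; elim: (index_enum _) => [|k s [j IH]].
    by exists 0; rewrite big_nil mul0r mulr0.
  rewrite big_cons; have [u [v <-]] := Bezoutz (c 0 k) (\big[gcdz/0]_(i <- s) c 0 i).
  have [i ck] := cT k; exists (u * i + v * j).
  by rewrite !intrD !intrM !mulrDl mulrDr -!mulrA ck IH; ring.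
have trig k : cos ((c 0 k)%:~R * T) = 1 /\ sin ((c 0 k)%:~R * T) = 0.
  have c1 : cos ((c 0 k)%:~R * T) = 1.
    apply/cos_eq1P; have /dvdzP[q ->] := gcd_coords_dvd c k.
    by exists (q * j); rewrite !intrM -mulrA gT; ring.
  split=> //; apply/eqP; rewrite -sqrf_eq0 sin2cos2 c1 expr1n subrr//.
have comp k : (gamma (t + T)).1 0 k = (gamma t).1 0 k /\
              (gamma (t + T)).2 0 k = (gamma t).2 0 k.
  have [-> ->] := gamma_rot (t + T) k; have [-> ->] := gamma_rot t k.
  have [c1 s0] := trig k.
  by rewrite mulrDr cosD sinD c1 s0 !mulr1 !mulr0 subr0 addr0.
move: comp; case: (gamma (t + T)) => x y; case: (gamma t) => x' y' /= comp.
by congr pair; apply/rowP => k; have [] := comp k.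
Qed.

Lemma gamma_minimal_period : gcd_coords c != 0 ->
  minimal_period gamma (2 * pi * (1 / `|gcd_coords c|%:~R)).
Proof.
move=> c0; have g0 : 0 < (gcd_coords c)%:~R :> R.
  by rewrite ltr0z lt_def c0 gcd_coords_ge0.
have pi2 : 0 < 2 * pi :> R by rewrite mulr_gt0// pi_gt0.
rewrite ger0_norm ?gcd_coords_ge0//; split=> [|T [T0 /gamma_period[j gT]]].
  split; first by rewrite mulr_gt0// divr_gt0.
  by apply/gamma_period; exists 1; field; rewrite gt_eqF.
(* The number of turns is a positive integer, so the least period is the one with [j = 1]. *)
have j_gt0 : 0 < j by rewrite -(ltr0z R) -(pmulr_rgt0 _ pi2) -gT mulr_gt0.
rewrite div1r ler_pdivrMr// [T * _]mulrC gT ler_peMr ?(ltW pi2)//.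
by rewrite ler1z -gtz0_ge1.
Qed.

End Period.

Lemma minimal_period_inj (R : realType) (n : nat) (gamma : R -> Cn R n) (T T' : R) :
  minimal_period gamma T -> minimal_period gamma T' -> T = T'.
Proof.
by move=> [pT mT] [pT' mT']; apply/eqP; rewrite eq_le mT// mT'.
Qed.

Theorem proposition5p11 (R : realType) (n : nat)
  (Sigma : set (set 'rV[R]_n)) (hSigma : complete_fan Sigma)
  (phi : 'rV[R]_n -> R)
  (hphi : rational_PL Sigma phi) (hconc : strictly_concave Sigma phi)
  (r : nat) (hr : (0 < r)%N) (hint : integral_PL Sigma (r%:R \*o phi))
  (eps : set 'rV[R]_n -> R)
  (heps : forall rho, fan_cones Sigma 1 rho -> 0 < eps rho)
  (sigma : set 'rV[R]_n) (hsigma : Sigma sigma)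
  (d : set 'rV[R]_n -> rat) (hd : L_ sigma d)
  (c : 'rV[int]_n) (hc : c_ sigma d = latt R c)
  (X : Cn R n -> Cn R n)
  (hX : hamiltonian_vf Sigma (r%:R \*o phi)
          (hamiltonian Sigma (r%:R \*o phi) eps) X)
  (gamma : R -> Cn R n) (hgamma : periodic_orbit X gamma)
  (hB : forall t, B_ Sigma (r%:R \*o phi) eps sigma d (gamma t)) :
  has_period gamma (1 / `|gcd_coords c|%:~R) /\
  (has_period gamma 1 <-> primitive c).
Proof.
have [gamma_torus dgamma _ [t0 gamma_t0]] := hgamma.
have finA := finite_lattice_points hSigma hconc (r%:R \*o phi).
have A_neq0 := lattice_points_nonempty hphi.1 hconc hr hint.
have A_span := lattice_points_span hSigma hphi.1 hconc hr hint.
have field_coord t k : (X (gamma t)).1 0 k = (c 0 k)%:~R * (gamma t).2 0 k /\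
                 (X (gamma t)).2 0 k = - ((c 0 k)%:~R * (gamma t).1 0 k).
  have [/rowP/(_ k) + /rowP/(_ k)] :=
    hamiltonian_flow_direction hSigma finA A_neq0 A_span hsigma (hB t) hc hX.
  have N0 := lt0r_neq0 (sqnorm_coord_gt0 k (gamma_torus t)).
  rewrite !mxE => /(canRL (divfK N0)); rewrite mul0r => re0 /(canRL (divfK N0)).
  move: N0 re0; rewrite /sqnorm_coord.
  move: (gamma t) (X (gamma t)) => [x y] [v1 v2] /=.
  move: (v1 0 k) (v2 0 k) (x 0 k) (y 0 k) ((c 0 k)%:~R : R).
  move=> {}v1 {}v2 {}x {}y C N0 re0 im; split; apply: (mulfI N0).
    (* Recover the velocity from the real and imaginary parts of its quotient by [z_k]; the result
       is [z_k' = - i c_k z_k]. *)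
    have -> : (x ^+ 2 + y ^+ 2) * v1 =
      x * (x * v1 + y * v2) - y * (x * v2 - y * v1) by ring.
    by rewrite re0 im; ring.
  have -> : (x ^+ 2 + y ^+ 2) * v2 =
    y * (x * v1 + y * v2) + x * (x * v2 - y * v1) by ring.
  by rewrite re0 im; ring.
have gamma_rot t k := rotation_flow
  (fun s => is_derive_eq (is_derive_re_path k (dgamma s)) (field_coord s k).1)
  (fun s => is_derive_eq (is_derive_im_path k (dgamma s)) (field_coord s k).2) t.
(* With gcd zero every real would be a period, so [gamma] would be constant, whereas a periodic
   orbit is not an equilibrium. *)
have c0 : gcd_coords c != 0.
  apply/eqP => g0; apply: gamma_t0; rewrite -[t0]add0r.
  move: 0; apply/(gamma_period gamma_torus gamma_rot).
  by exists 0; rewrite g0 mul0r mulr0.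
have min_period := gamma_minimal_period gamma_torus gamma_rot c0.
split=> //; rewrite primitive_gcd1; split=> [period1|g1].
  have := minimal_period_inj min_period period1.
  have pi2 : 2 * pi != 0 :> R by rewrite mulf_neq0// gt_eqF// pi_gt0.
  move=> /(mulfI pi2); rewrite div1r => /(canRL invrK); rewrite invr1 => g1.
  by apply/eqP; rewrite -(eqr_int R) g1.
by move: min_period; rewrite g1 divr1.
Qed.
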